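(* Let $\mathbb{F}$ be an arbitrary field, let $E$ be the natural $2$-dimensional representation of $\mathrm{SL}_2(\mathbb{F})$, let $N \ge 1$ and $d \ge 0$ be integers. The linear map $\phi$ defined in the context is an isomorphism of $\mathrm{SL}_2(\mathbb{F})$-representations from its domain onto the subrepresentation $\Delta^{(2,1^{N-1})}\mathrm{Sym}^d E$ of its codomain: \[ \phi:\ \mathrm{Sym}^{N-1}E \otimes \bigwedge^{N+1}\mathrm{Sym}^{d+1}E \ \xrightarrow{\ \cong\ }\ \Delta^{(2,1^{N-1})}\mathrm{Sym}^d E. \]
   Context: Fix the basis $X,Y$ of $E$. For $c\ge 0$, $\mathrm{Sym}^cE$ is the space of homogeneous polynomials of degree $c$ in $X,Y$ (the quotient version of the symmetric power), with basis $X^{c-i}Y^i$, $0\le i\le c$, with the induced action of $\mathrm{SL}_2(\mathbb{F})$. Exterior powers and tensor products carry the induced actions. For a vector space $V$, $\Delta^{(2,1^{N-1})}V$ is the kernel of the multiplication map $\mu_N:\bigwedge^N V\otimes V\to\bigwedge^{N+1}V$, $v_1\wedge\cdots\wedge v_N\otimes w\mapsto v_1\wedge\cdots\wedge v_N\wedge w$. For $c,r\ge 0$ let $I^{(c)}(r)=\{0,1,\ldots,c\}^r$. For $\mathbf{i}\in I^{(c)}(r)$ put $|\mathbf{i}|=\sum_{\alpha}i_\alpha$ and $F^{(c)}_\wedge(\mathbf{i})=X^{c-i_1}Y^{i_1}\wedge\cdots\wedge X^{c-i_r}Y^{i_r}\in\bigwedge^r\mathrm{Sym}^cE$; those with $\mathbf{i}$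 strictly increasing form a basis. For $\mathbf{i}\in I^{(d)}(N)$ and $j\in\{0,\ldots,d\}$ put $F(\mathbf{i},j)=F^{(d)}_\wedge(\mathbf{i})\otimes X^{d-j}Y^j\in\bigwedge^N\mathrm{Sym}^dE\otimes\mathrm{Sym}^dE$. Write $[a,b)=\{a,a+1,\ldots,b-1\}$. For strictly increasing $\mathbf{k}\in I^{(d+1)}(N+1)$ let $\mathcal{B}(\mathbf{k})=[k_1,k_2)\times[k_2,k_3)\times\cdots\times[k_N,k_{N+1})\subseteq I^{(d)}(N)$. The linear map $\phi:\mathrm{Sym}^{N-1}E\otimes\bigwedge^{N+1}\mathrm{Sym}^{d+1}E\to\bigwedge^N\mathrm{Sym}^dE\otimes\mathrm{Sym}^dE$ is defined on the basis elements, for $s\in\{0,1,\ldots,N-1\}$ and $\mathbf{k}\in I^{(d+1)}(N+1)$ strictly increasing, by \[\phi\bigl(X^{N-1-s}Y^s\otimes F^{(d+1)}_\wedge(\mathbf{k})\bigr)=\sum_{\mathbf{i}\in\mathcal{B}(\mathbf{k})}F\bigl(\mathbf{i},\,s+|\mathbf{k}|-N-|\mathbf{i}|\bigr),\] where the second argument always lies in $\{0,\ldots,d\}$. *)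

(* Defs.v *)
From HB Require Import structures.
From mathcomp Require Import all_boot all_order all_algebra all_fingroup.
From mathcomp Require Import generic_quotient boolp.
From mathcomp Require Import freeg mpoly.

Set Implicit Arguments.
Unset Strict Implicit.
Unset Printing Implicit Defensive.

Import GRing.Theory.
Local Open Scope ring_scope.

Section LinearQuotient.
Variables (F : fieldType) (V : lmodType F) (rel : V -> Prop).

Inductive lspan : V -> Prop :=
| lspan_nil : lspan 0
| lspan_cons a u v : rel u -> lspan v -> lspan (a *: u + v).

Lemma lspanD u v : lspan u -> lspan v -> lspan (u + v).
Proof.
elim=> [|a w u' Rw _ IH] Sv; first by rewrite add0r.
by rewrite -addrA; apply: lspan_cons => //; apply: IH.
Qed.

Lemma lspanZ a v : lspan v -> lspan (a *: v).
Proof.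
elim=> [|b u w Ru _ IH]; first by rewrite scaler0; apply: lspan_nil.
by rewrite scalerDr scalerA; apply: lspan_cons.
Qed.

Lemma lspan_rel u : rel u -> lspan u.
Proof.
by move=> Ru; rewrite -[u]scale1r -[_ *: _]addr0;
   apply: lspan_cons => //; apply: lspan_nil.
Qed.

Definition lspan_pred : {pred V} := fun v => `[< lspan v >].

Lemma lspan_zmod_closed : zmod_closed lspan_pred.
Proof.
split; first exact/asboolP/lspan_nil.
move=> u v /asboolP Su /asboolP Sv; apply/asboolP.
by rewrite -scaleN1r; apply: lspanD => //; apply: lspanZ.
Qed.

HB.instance Definition _ :=
  GRing.isZmodClosed.Build V lspan_pred lspan_zmod_closed.

Definition lquot := Quotient.quot (lspan_pred : zmodClosed V).
HB.instance Definition _ := GRing.Zmodule.on lquot.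
HB.instance Definition _ := EqQuotient.on lquot.

Definition lquot_pi (v : V) : lquot := (\pi_lquot v)%qT.

Lemma lquot_piP u v : lquot_pi u = lquot_pi v <-> lspan (u - v).
Proof.
split=> [/eqP|Suv].
  by rewrite /lquot_pi -Quotient.idealrBE => /asboolP.
by apply/eqP; rewrite /lquot_pi -Quotient.idealrBE; apply/asboolP.
Qed.

Lemma lquot_piK (q : lquot) : lquot_pi (repr q) = q.
Proof. exact: reprK. Qed.

Lemma lquot_pi_zmod : zmod_morphism lquot_pi.
Proof. by move=> u v; rewrite /lquot_pi !piE. Qed.

HB.instance Definition _ :=
  GRing.isZmodMorphism.Build V lquot lquot_pi lquot_pi_zmod.

Definition lquot_scale a (q : lquot) : lquot := lquot_pi (a *: repr q).

Lemma lquot_scale_pi a v : lquot_scale a (lquot_pi v) = lquot_pi (a *: v).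
Proof.
apply/lquot_piP; rewrite -scalerBr; apply: lspanZ.
by apply/lquot_piP; rewrite lquot_piK.
Qed.

Lemma lquot_scaleA a b q :
  lquot_scale a (lquot_scale b q) = lquot_scale (a * b) q.
Proof. by rewrite -[q]lquot_piK !lquot_scale_pi scalerA. Qed.

Lemma lquot_scale1 : left_id 1 lquot_scale.
Proof. by move=> q; rewrite -[q]lquot_piK lquot_scale_pi scale1r. Qed.

Lemma lquot_scaleDr : right_distributive lquot_scale +%R.
Proof.
move=> a p q; rewrite -[p]lquot_piK -[q]lquot_piK.
by rewrite -raddfD !lquot_scale_pi -raddfD scalerDr.
Qed.

Lemma lquot_scaleDl q : {morph lquot_scale^~ q : a b / a + b}.
Proof.
by move=> a b; rewrite -[q]lquot_piK !lquot_scale_pi -raddfD scalerDl.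
Qed.

HB.instance Definition _ := GRing.Zmodule_isLmodule.Build F lquot
  lquot_scaleA lquot_scale1 lquot_scaleDr lquot_scaleDl.

Lemma lquot_pi_scalable : scalable lquot_pi.
Proof. by move=> a v; rewrite -lquot_scale_pi. Qed.

HB.instance Definition _ :=
  GRing.isScalable.Build F V lquot _ lquot_pi lquot_pi_scalable.

Lemma lquot_pi_rel u : rel u -> lquot_pi u = 0.
Proof.
move=> Ru; rewrite -(raddf0 lquot_pi); apply/lquot_piP.
by rewrite subr0; apply: lspan_rel.
Qed.

Section Lift.
Variables (W : lmodType F) (f : {linear V -> W}).

Definition lquot_lift (_ : forall u, rel u -> f u = 0) (q : lquot) : W :=
  f (repr q).

Hypothesis f_rel : forall u, rel u -> f u = 0.

Lemma lspan_ker u : lspan u -> f u = 0.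
Proof.
elim=> [|a v w Rv _ IH]; first exact: linear0.
by rewrite linearP IH f_rel // scaler0 addr0.
Qed.

Lemma lquot_liftE v : lquot_lift f_rel (lquot_pi v) = f v.
Proof.
apply/eqP; rewrite -subr_eq0 /lquot_lift -linearB; apply/eqP.
by apply: lspan_ker; apply/lquot_piP; rewrite lquot_piK.
Qed.

Lemma lquot_lift_linear : linear (lquot_lift f_rel).
Proof.
move=> a p q; rewrite -[p]lquot_piK -[q]lquot_piK -linearP.
by rewrite !lquot_liftE linearP.
Qed.

HB.instance Definition _ := GRing.isLinear.Build F lquot W _
  (lquot_lift f_rel) lquot_lift_linear.
End Lift.
End LinearQuotient.

Section FreeModule.
Variables (F : fieldType) (K : choiceType).

Definition fgen (x : K) : {freeg K / F} := << x >>.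

Section Lift.
Variables (W : lmodType F) (f : K -> W).

Definition free_lift (D : {freeg K / F}) : W := fglift f D.

Lemma free_liftE x : free_lift (fgen x) = f x.
Proof. by rewrite /free_lift liftU scale1r. Qed.

Lemma free_lift_zmod : zmod_morphism free_lift.
Proof. exact: lift_is_additive. Qed.

HB.instance Definition _ :=
  GRing.isZmodMorphism.Build {freeg K / F} W free_lift free_lift_zmod.

Lemma free_lift_scalable : scalable free_lift.
Proof.
move=> a D; rewrite [a *: D]/(fgscale a D) /fgscale raddf_sum.
rewrite -[in RHS](freeg_sumE D) raddf_sum scaler_sumr.
by apply: eq_bigr => x _; rewrite /= /free_lift !liftU scalerA.
Qed.

HB.instance Definition _ :=
  GRing.isScalable.Build F {freeg K / F} W _ free_lift free_lift_scalable.
End Lift.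

Lemma free_ext (W : lmodType F) (f g : {linear {freeg K / F} -> W}) :
  (forall x, f (fgen x) = g (fgen x)) -> f =1 g.
Proof.
move=> fg D; rewrite -(freeg_sumE D) !raddf_sum; apply: eq_bigr => x _ /=.
have -> : << coeff x D *g x >> = coeff x D *: fgen x.
  by apply/eqP/freeg_eqP=> y; rewrite coeffZ !coeffU mul1r.
by rewrite !linearZ fg.
Qed.
End FreeModule.

Section Tensor.
Variables (F : fieldType) (V W : lmodType F).

Local Notation gen v w := (@fgen F (V * W)%type (v, w)).

Inductive tensor_rel : {freeg (V * W) / F} -> Prop :=
| tensor_rel_l a v v' w :
    tensor_rel (gen (a *: v + v') w - (a *: gen v w + gen v' w))
| tensor_rel_r a v w w' :
    tensor_rel (gen v (a *: w + w') - (a *: gen v w + gen v w')).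

Definition tensor : lmodType F := lquot tensor_rel.

Definition tens (v : V) (w : W) : tensor := lquot_pi tensor_rel (gen v w).

Definition bilin (U : lmodType F) (f : V -> W -> U) : Prop :=
  (forall w, linear (f^~ w)) /\ (forall v, linear (f v)).

Lemma tens_bilin : bilin tens.
Proof.
split=> [w a v v'|v a w w']; rewrite /tens -linearP; apply/lquot_piP.
  by apply: lspan_rel; apply: tensor_rel_l.
by apply: lspan_rel; apply: tensor_rel_r.
Qed.

HB.instance Definition _ v :=
  GRing.isLinear.Build F W tensor _ (tens v) (tens_bilin.2 v).

Section Lift.
Variables (U : lmodType F) (f : V -> W -> U) (f_bilin : bilin f).

Lemma tensor_lift_rel u :
  tensor_rel u -> free_lift (fun vw => f vw.1 vw.2) u = 0.
Proof.
case: f_bilin => fl fr; case=> [a v v' w|a v w w'].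
  by rewrite linearB linearP /= !free_liftE /= fl subrr.
by rewrite linearB linearP /= !free_liftE /= fr subrr.
Qed.

Definition tensor_lift : tensor -> U := lquot_lift tensor_lift_rel.
HB.instance Definition _ := GRing.Linear.on tensor_lift.

Lemma tensor_liftE v w : tensor_lift (tens v w) = f v w.
Proof. exact: etrans (lquot_liftE tensor_lift_rel _) (free_liftE _ _). Qed.
End Lift.

Lemma tensor_ext (U : lmodType F) (f g : {linear tensor -> U}) :
  (forall v w, f (tens v w) = g (tens v w)) -> f =1 g.
Proof.
move=> fg q; rewrite -[q]lquot_piK.
by apply: (@free_ext _ _ _ (f \o lquot_pi tensor_rel)
                         (g \o lquot_pi tensor_rel)) => -[v w]; apply: fg.
Qed.
End Tensor.

Section Exterior.
Variables (F : fieldType) (r : nat) (V : lmodType F).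

Definition upd (v : {ffun 'I_r -> V}) (i : 'I_r) (x : V) : {ffun 'I_r -> V} :=
  [ffun j => if j == i then x else v j].

Local Notation gen := (@fgen F {ffun 'I_r -> V}).

Inductive ext_rel : {freeg {ffun 'I_r -> V} / F} -> Prop :=
| ext_rel_linear (v : {ffun 'I_r -> V}) i a x y :
    ext_rel (gen (upd v i (a *: x + y))
             - (a *: gen (upd v i x) + gen (upd v i y)))
| ext_rel_alt (v : {ffun 'I_r -> V}) i j : i != j -> v i = v j -> ext_rel (gen v).

Definition ext : lmodType F := lquot ext_rel.

Definition wedge (v : {ffun 'I_r -> V}) : ext := lquot_pi ext_rel (gen v).

Definition alternating (U : lmodType F) (f : {ffun 'I_r -> V} -> U) : Prop :=
  (forall (v : {ffun 'I_r -> V}) i, linear (fun x => f (upd v i x))) /\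
  (forall (v : {ffun 'I_r -> V}) i j, i != j -> v i = v j -> f v = 0).

Lemma wedge_alternating : alternating wedge.
Proof.
split=> [v i a x y|v i j ij vij].
  rewrite /wedge -linearP; apply/lquot_piP.
  by apply: lspan_rel; apply: ext_rel_linear.
by apply: lquot_pi_rel; apply: ext_rel_alt vij.
Qed.

Section Lift.
Variables (U : lmodType F) (f : {ffun 'I_r -> V} -> U).
Hypothesis f_alt : alternating f.

Lemma ext_lift_rel u : ext_rel u -> free_lift f u = 0.
Proof.
case: f_alt => fl fa; case=> [v i a x y|v i j ij vij].
  by rewrite linearB linearP /= !free_liftE fl subrr.
by rewrite free_liftE (fa v i j).
Qed.

Definition ext_lift : ext -> U := lquot_lift ext_lift_rel.
HB.instance Definition _ := GRing.Linear.on ext_lift.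

Lemma ext_liftE v : ext_lift (wedge v) = f v.
Proof. exact: etrans (lquot_liftE ext_lift_rel _) (free_liftE _ _). Qed.
End Lift.

Lemma ext_ext (U : lmodType F) (f g : {linear ext -> U}) :
  (forall v, f (wedge v) = g (wedge v)) -> f =1 g.
Proof.
move=> fg q; rewrite -[q]lquot_piK.
by apply: (@free_ext _ _ _ (f \o lquot_pi ext_rel)
                         (g \o lquot_pi ext_rel)) => v; apply: fg.
Qed.
End Exterior.

Arguments tensor_lift {F V W U f} f_bilin x : simpl never.
Arguments ext_lift {F r V U f} f_alt x : simpl never.

Section Functoriality.
Variable F : fieldType.

Lemma tensor_map_bilin (V V' W W' : lmodType F) (f : {linear V -> V'})
    (g : {linear W -> W'}) : bilin (fun v w => tens (f v) (g w)).
Proof.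
have [tl tr] := tens_bilin V' W'.
by split=> [w|v] a x y /=; rewrite linearP ?(tl (g w)) ?(tr (f v)).
Qed.

Definition tensor_map (V V' W W' : lmodType F) (f : {linear V -> V'})
    (g : {linear W -> W'}) : tensor V W -> tensor V' W' :=
  tensor_lift (tensor_map_bilin f g).
Arguments tensor_map [V V' W W'] f g x : simpl never.
HB.instance Definition _ (V V' W W' : lmodType F) (f : {linear V -> V'})
    (g : {linear W -> W'}) := GRing.Linear.on (tensor_map f g).

Lemma tensor_mapE (V V' W W' : lmodType F) (f : {linear V -> V'})
    (g : {linear W -> W'}) v w :
  tensor_map f g (tens v w) = tens (f v) (g w).
Proof. exact: (tensor_liftE (tensor_map_bilin f g)). Qed.

Lemma ext_map_alternating r (V W : lmodType F) (f : {linear V -> W}) :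
  alternating (fun v : {ffun 'I_r -> V} => wedge [ffun i => f (v i)]).
Proof.
have [wl wa] := wedge_alternating r W.
have updf (v : {ffun 'I_r -> V}) i x :
    [ffun j => f (upd v i x j)] = upd [ffun j => f (v j)] i (f x).
  by apply/ffunP=> j; rewrite !ffunE; case: eqP.
split=> [v i a x y|v i j ij vij]; first by rewrite !updf linearP wl.
by apply: (wa _ i j ij); rewrite !ffunE vij.
Qed.

Definition ext_map r (V W : lmodType F) (f : {linear V -> W}) :
    ext r V -> ext r W :=
  ext_lift (ext_map_alternating r f).
Arguments ext_map r [V W] f x : simpl never.
HB.instance Definition _ r (V W : lmodType F) (f : {linear V -> W}) :=
  GRing.Linear.on (ext_map r f).

Lemma ext_mapE r (V W : lmodType F) (f : {linear V -> W})
    (v : {ffun 'I_r -> V}) :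
  ext_map r f (wedge v) = wedge [ffun i => f (v i)].
Proof. exact: (ext_liftE (ext_map_alternating r f)). Qed.
End Functoriality.

Arguments tensor_map {F V V' W W'} f g x : simpl never.
Arguments ext_map {F} r {V W} f x : simpl never.

Section Representations.
Variables (F : fieldType) (G : groupType).

Record representation (V : lmodType F) := Representation {
  ract :> G -> {linear V -> V};
  ract1 : forall v, ract 1%g v = v;
  ractM : forall g h v, ract (g * h)%g v = ract g (ract h v)
}.

Section TensorRep.
Variables (V W : lmodType F) (rV : representation V) (rW : representation W).

Definition tensor_act g : {linear tensor V W -> tensor V W} :=
  tensor_map (rV g) (rW g) : {linear _ -> _}.

Lemma tensor_act1 x : tensor_act 1%g x = x.
Proof.
apply: (@tensor_ext _ _ _ _ (tensor_act 1%g) idfun) => v w.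
by rewrite /= tensor_mapE !ract1.
Qed.

Lemma tensor_actM g h x : tensor_act (g * h)%g x = tensor_act g (tensor_act h x).
Proof.
apply: (@tensor_ext _ _ _ _ (tensor_act _) (tensor_act g \o tensor_act h)) => v w.
by rewrite /= !tensor_mapE !ractM.
Qed.

Definition tensor_rep := Representation tensor_act1 tensor_actM.
End TensorRep.

Section ExtRep.
Variables (r : nat) (V : lmodType F) (rV : representation V).

Definition ext_act g : {linear ext r V -> ext r V} :=
  ext_map r (rV g) : {linear _ -> _}.

Lemma ext_act1 x : ext_act 1%g x = x.
Proof.
apply: (@ext_ext _ _ _ _ (ext_act 1%g) idfun) => v.
rewrite /= ext_mapE; congr wedge.
by apply/ffunP=> i; rewrite ffunE ract1.
Qed.

Lemma ext_actM g h x : ext_act (g * h)%g x = ext_act g (ext_act h x).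
Proof.
apply: (@ext_ext _ _ _ _ (ext_act _) (ext_act g \o ext_act h)) => v.
rewrite /= !ext_mapE; congr wedge.
by apply/ffunP=> i; rewrite !ffunE ractM.
Qed.

Definition ext_rep := Representation ext_act1 ext_actM.
End ExtRep.

Record subrepresentation (V : lmodType F) (rV : representation V)
    (S : {pred V}) : Prop := {
  subrep_closed : submod_closed S;
  subrep_stable : forall g v, v \in S -> rV g v \in S
}.

Record rep_iso_onto (V W : lmodType F) (rV : representation V)
    (rW : representation W) (S : {pred W}) (f : {linear V -> W}) : Prop := {
  iso_subrep : subrepresentation rW S;
  iso_equivariant : forall g v, f (rV g v) = rW g (f v);
  iso_injective : injective f;
  iso_image : forall w, w \in S <-> exists v, f v = w
}.
End Representations.

Section SL2.
Variable F : fieldType.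

Record SL2 := MkSL2 { SL2val :> 'M[F]_2; _ : \det SL2val == 1 }.

HB.instance Definition _ := [isSub for SL2val].
HB.instance Definition _ := [Choice of SL2 by <:].

Lemma SL2_det (g : SL2) : \det g = 1.
Proof. by case: g => g /= /eqP. Qed.

Fact SL2_one_subproof : \det (1%:M : 'M[F]_2) == 1.
Proof. by rewrite det1. Qed.
Fact SL2_mul_subproof (g h : SL2) : \det (g *m h) == 1.
Proof. by rewrite det_mulmx !SL2_det mulr1. Qed.
Fact SL2_inv_subproof (g : SL2) : \det (invmx g) == 1.
Proof. by rewrite det_inv SL2_det invr1. Qed.

Definition SL2_one := MkSL2 SL2_one_subproof.
Definition SL2_mul g h := MkSL2 (SL2_mul_subproof g h).
Definition SL2_inv g := MkSL2 (SL2_inv_subproof g).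

Lemma SL2_unit (g : SL2) : (g : 'M_2) \in unitmx.
Proof. by rewrite unitmxE SL2_det unitr1. Qed.

Fact SL2_mulA : associative SL2_mul.
Proof. by move=> g h k; apply: val_inj; rewrite /= mulmxA. Qed.
Fact SL2_mul1g : left_id SL2_one SL2_mul.
Proof. by move=> g; apply: val_inj; rewrite /= mul1mx. Qed.
Fact SL2_mulg1 : right_id SL2_one SL2_mul.
Proof. by move=> g; apply: val_inj; rewrite /= mulmx1. Qed.
Fact SL2_mulVg : left_inverse SL2_one SL2_inv SL2_mul.
Proof. by move=> g; apply: val_inj; rewrite /= mulVmx // SL2_unit. Qed.
Fact SL2_mulgV : right_inverse SL2_one SL2_inv SL2_mul.
Proof. by move=> g; apply: val_inj; rewrite /= mulmxV // SL2_unit. Qed.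

HB.instance Definition _ := isGroup.Build SL2
  SL2_mulA SL2_mul1g SL2_mulg1 SL2_mulVg SL2_mulgV.
End SL2.

(* The variables 'X_0 and 'X_1 of {mpoly F[2]} are the basis X, Y of E, and
   SL2 F acts on E by its matrices with respect to this basis. *)
Section Sym.
Variables (F : fieldType) (c : nat).

Definition Sym : lmodType F := dhomog 2 F c.

(* The exponents of X ^ (c - i) * Y ^ i. *)
Definition symm (i : 'I_c.+1) : 'X_{1..2} :=
  [multinom (if j == ord0 then c - i else i)%N | j < 2].

Lemma symm_homog i : ('X_[F, symm i] : {mpoly F[2]}) \is c.-homog.
Proof.
rewrite dhomogX /= mdegE big_ord_recl big_ord1 !mnmE /=.
by rewrite subnK // -ltnS.
Qed.

Definition symX i : Sym := DHomog (symm_homog i).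

Definition symcoef (i : 'I_c.+1) (p : Sym) : F := (p : {mpoly F[2]})@_(symm i).

Lemma symcoef_linear i : linear_for *%R (symcoef i).
Proof. by move=> a p q; rewrite /symcoef /= mcoeffD mcoeffZ. Qed.

HB.instance Definition _ i :=
  GRing.isLinear.Build F Sym F _ (symcoef i) (symcoef_linear i).

Lemma symm_inj : injective symm.
Proof.
move=> i j /mnmP /(_ ord_max).
by rewrite !mnmE /= => /val_inj.
Qed.

Lemma symcoefX i j : symcoef i (symX j) = (j == i)%:R.
Proof. by rewrite /symcoef /= mcoeffX (inj_eq symm_inj). Qed.

(* g X and g Y, with coordinates the columns of g. *)
Definition sym_subst (g : SL2 F) : 2.-tuple {mpoly F[2]} :=
  [tuple \sum_(i < 2) (g : 'M_2) i j *: 'X_i | j < 2].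

Lemma sym_subst_homog g (p : Sym) : (p : {mpoly F[2]}) \mPo sym_subst g \is c.-homog.
Proof.
have hom1 j : tnth (sym_subst g) j \is 1.-homog.
  rewrite tnth_mktuple; apply: rpred_sum => i _; apply: rpredZ.
  by rewrite dhomogX /= mdeg1.
rewrite comp_mpolyE big_seq; apply: rpred_sum => m mp; apply: rpredZ.
have /dhomogP/(_ m mp) /= <- := dhomog_is_dhomog p.
rewrite mdegE !big_ord_recl !big_ord0 addn0 mulr1.
by apply: dhomogM; rewrite -[X in X.-homog]mul1n; apply: dhomogMn.
Qed.

Definition sym_act (g : SL2 F) (p : Sym) : Sym := DHomog (sym_subst_homog g p).

Lemma sym_act_linear g : linear (sym_act g).
Proof. by move=> a p q; apply: val_inj; rewrite /= !linearP. Qed.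

HB.instance Definition _ g :=
  GRing.isLinear.Build F Sym Sym _ (sym_act g) (sym_act_linear g).

Lemma sym_act1 p : sym_act 1%g p = p.
Proof.
apply: val_inj => /=; rewrite -[RHS]comp_mpoly_id; congr comp_mpoly.
apply: eq_from_tnth => j; rewrite !tnth_mktuple (bigD1 j) //= mxE eqxx scale1r.
by rewrite big1 ?addr0 // => i /negPf ij; rewrite mxE ij scale0r.
Qed.

Lemma sym_actM g h p : sym_act (g * h)%g p = sym_act g (sym_act h p).
Proof.
apply: val_inj => /=.
rewrite comp_mpolyE (comp_mpolyE _ (sym_subst h)) raddf_sum /=.
apply: eq_bigr => m _; rewrite comp_mpolyZ rmorph_prod /=; congr (_ *: _).
apply: eq_bigr => j _; rewrite rmorphXn /=; congr (_ ^+ _).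
rewrite !tnth_mktuple raddf_sum /=.
under [RHS]eq_bigr => i _.
  rewrite comp_mpolyZ comp_mpolyXU -tnth_nth tnth_mktuple scaler_sumr.
  under eq_bigr => k _ do rewrite scalerA mulrC.
  over.
rewrite exchange_big /=; apply: eq_bigr => k _.
by rewrite -scaler_suml mxE.
Qed.

Definition sym_rep : representation (SL2 F) Sym :=
  @Representation F (SL2 F) Sym (fun g => sym_act g : {linear _ -> _})
    sym_act1 sym_actM.
End Sym.

Section Multiplication.
Variables (F : fieldType) (N : nat) (V : lmodType F).

Definition snoc (v : {ffun 'I_N -> V}) (w : V) : {ffun 'I_N.+1 -> V} :=
  [ffun i => oapp v w (unlift ord_max i)].

Lemma snoc_upd v i x w :
  snoc (upd v i x) w = upd (snoc v w) (fintype.lift ord_max i) x.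
Proof.
apply/ffunP=> j; rewrite !ffunE.
case: unliftP => [j' ->|->] /=; last by rewrite (negPf (neq_lift _ _)).
by rewrite ffunE (inj_eq lift_inj).
Qed.

Lemma snoc_upd_last v w : snoc v w = upd (snoc v 0) ord_max w.
Proof.
apply/ffunP=> j; rewrite !ffunE.
by case: unliftP => [j' ->|->] /=; rewrite ?eqxx // eq_sym (negPf (neq_lift _ _)).
Qed.

Lemma snoc_alternating w : alternating (fun v => wedge (snoc v w)).
Proof.
have [wl wa] := wedge_alternating N.+1 V.
split=> [v i a x y|v i j ij vij]; first by rewrite !snoc_upd wl.
apply: (wa _ (fintype.lift ord_max i) (fintype.lift ord_max j)).
  by rewrite (inj_eq lift_inj).
by rewrite !ffunE !liftK /= vij.
Qed.

Lemma snoc_bilin : bilin (fun x w => ext_lift (snoc_alternating w) x).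
Proof.
have [wl _] := wedge_alternating N.+1 V.
split=> [w a x y|x a w w']; first exact: linearP.
pose f := a \*: ext_lift (snoc_alternating w) \+ ext_lift (snoc_alternating w').
apply: (@ext_ext _ _ _ _ (ext_lift (snoc_alternating (a *: w + w'))) f) => v.
by rewrite /f /= !ext_liftE snoc_upd_last wl -!snoc_upd_last.
Qed.

(* (v_1 /\ ... /\ v_N) (x) w |-> v_1 /\ ... /\ v_N /\ w *)
Definition mulwedge : tensor (ext N V) V -> ext N.+1 V :=
  tensor_lift snoc_bilin.
HB.instance Definition _ := GRing.Linear.on mulwedge.

Lemma mulwedgeE v w : mulwedge (tens (wedge v) w) = wedge (snoc v w).
Proof. by rewrite [LHS]tensor_liftE ext_liftE. Qed.

Definition Delta : {pred tensor (ext N V) V} := fun x => mulwedge x == 0.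
End Multiplication.

Arguments Delta {F} N V x.

Section Indices.

(* Indices are shifted by one: k_1, ..., k_r are k 0, ..., k (r - 1). *)
Definition mindex (c r : nat) := {ffun 'I_r -> 'I_c.+1}.

Definition weight c r (i : mindex c r) : nat := (\sum_(a < r) i a)%N.

Definition increasing c r (i : mindex c r) : bool :=
  [forall a : 'I_r, forall b : 'I_r, (a < b)%N ==> (i a < i b)%N].

Definition box d N (k : mindex d.+1 N.+1) : {set mindex d N} :=
  [set i : mindex d N | [forall a : 'I_N,
     (k (widen_ord (leqnSn N) a) <= i a < k (fintype.lift ord0 a))%N]].

Lemma increasing_inj c r (i : mindex c r) : increasing i -> injective i.
Proof.
move=> /forallP i_incr a b iab; apply/val_inj/eqP; move: iab.
case: ltngtP => // ab iab.
  by move: (i_incr a) => /forallP/(_ b); rewrite ab iab ltnn.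
by move: (i_incr b) => /forallP/(_ a); rewrite ab iab ltnn.
Qed.

Lemma increasing_sorted c r (i : mindex c r) : increasing i ->
  sorted (fun x y : 'I_c.+1 => (x < y)%N) (codom i).
Proof.
move=> /forallP i_incr; rewrite codomE.
apply: (@homo_sorted _ _ i (fun a b : 'I_r => (a < b)%N)) => [a b ab|].
  by move: (i_incr a) => /forallP/(_ b); rewrite ab.
by rewrite -(@sorted_map _ _ val ltn) val_enum_ord iota_ltn_sorted.
Qed.

Lemma increasing_eq c r (i k : mindex c r) : increasing i -> increasing k ->
  {subset codom i <= codom k} -> i = k.
Proof.
move=> i_incr k_incr ik.
have i_uniq : uniq (codom i) by apply/injectiveP; apply: increasing_inj.
have [|_ eq_ik] := uniq_min_size i_uniq ik; first by rewrite !size_codom.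
have eq_codom_ik : codom i = codom k.
  apply: irr_sorted_eq eq_ik; try exact: increasing_sorted.
    by move=> y x z; apply: ltn_trans.
  by move=> x; apply: ltnn.
move: eq_codom_ik; rewrite !codomE => /eq_in_map eq_ik_fun.
by apply/ffunP=> a; apply: eq_ik_fun; rewrite mem_enum.
Qed.

Lemma box_bounds d N (k : mindex d.+1 N.+1) (i : mindex d N) s :
  (s < N)%N -> i \in box k ->
  (N + weight i <= s + weight k <= N + weight i + d)%N.
Proof.
rewrite inE => sN /forallP ik.
have lo : (N + weight i <= weight k)%N.
  rewrite /weight [X in (_ <= X)%N]big_ord_recl.
  apply: leq_trans (leq_addl _ _).
  rewrite -[X in (X + _)%N](card_ord N) -sum1_card -big_split /=.
  by apply: leq_sum => a _; rewrite add1n; case/andP: (ik a).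
have hi : (weight k <= weight i + d.+1)%N.
  rewrite /weight big_ord_recr /=; apply: leq_add; last by rewrite -ltnS.
  by apply: leq_sum => a _; case/andP: (ik a).
rewrite (leq_trans lo) ?leq_addl //=.
apply: leq_trans (leq_add (leqnn s) hi) _.
by rewrite !addnS -addSn addnA !leq_add2r.
Qed.
End Indices.

Section Phi.
Variables (F : fieldType) (N d : nat).

Definition Fwedge c r (i : mindex c r) : ext r (Sym F c) :=
  wedge [ffun a => symX F (i a)].

Definition Ften (i : mindex d N) (j : 'I_d.+1) :
    tensor (ext N (Sym F d)) (Sym F d) :=
  tens (Fwedge i) (symX F j).

(* By box_bounds, neither the subtractions nor inord are ever out of range. *)
Definition phi_val (s : nat) (k : mindex d.+1 N.+1) :
    tensor (ext N (Sym F d)) (Sym F d) :=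
  \sum_(i in box k) Ften i (inord (s + weight k - N - weight i)%N).

Section Coordinates.
Variables (c r : nat) (k : mindex c r).

Lemma coord_det_alternating : alternating
  (fun v : {ffun 'I_r -> Sym F c} =>
     \det (\matrix_(a, b) symcoef (k b) (v a)) : F^o).
Proof.
split=> [v i a x y|v i j ij vij]; last first.
  by apply: (determinant_alternate ij) => b; rewrite !mxE vij.
rewrite /= -[\det _ in X in _ = _ + X]mul1r.
apply: (@determinant_multilinear _ _ _ _ _ i) => /=.
- by apply/rowP=> b; rewrite !mxE !ffunE !eqxx linearP mul1r.
- apply/matrixP=> u b; rewrite !mxE !ffunE.
  by rewrite eq_sym (negPf (neq_lift _ _)).
- apply/matrixP=> u b; rewrite !mxE !ffunE.
  by rewrite eq_sym (negPf (neq_lift _ _)).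
Qed.

Definition ext_coord : ext r (Sym F c) -> F^o := ext_lift coord_det_alternating.
HB.instance Definition _ := GRing.Linear.on ext_coord.

Lemma ext_coordE (i : mindex c r) :
  increasing k -> increasing i -> ext_coord (Fwedge i) = (i == k)%:R.
Proof.
move=> k_incr i_incr; rewrite /ext_coord ext_liftE.
have [->|ik] := eqVneq i k.
  rewrite -[RHS](det1 F r); congr (\det _); apply/matrixP=> a b.
  by rewrite !mxE !ffunE symcoefX (inj_eq (increasing_inj k_incr)).
have [a ka] : exists a, i a \notin codom k.
  apply/existsP; apply: contraNT ik => /existsPn nk; apply/eqP.
  apply: increasing_eq => // _ /codomP[a ->].
  by move: (nk a); rewrite negbK.
rewrite (expand_det_row _ a) big1 // => b _; rewrite !mxE !ffunE symcoefX.
have [ikab|_] := eqVneq; last by rewrite mul0r.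
by rewrite ikab codom_f in ka.
Qed.
End Coordinates.

Lemma phi_bilin :
  bilin (fun (f : Sym F N.-1) (w : ext N.+1 (Sym F d.+1)) =>
    \sum_(s < N.-1.+1) \sum_(k : mindex d.+1 N.+1 | increasing k)
      (symcoef s f * ext_coord k w) *: phi_val s k).
Proof.
split=> [w a f g|f a w w'] /=; rewrite scaler_sumr -big_split /=;
  apply: eq_bigr => s _; rewrite scaler_sumr -big_split /=;
  apply: eq_bigr => k _; rewrite linearP scalerA -scalerDl; congr (_ *: _).
  by rewrite mulrDl mulrA.
by rewrite mulrDr mulrCA.
Qed.

(* The basis vectors are read off through coordinates; phi_basis and phi_unique
   below say that phi is the linear map with the prescribed values on the basis.
   It is only meaningful for N > 0, as N.-1 is 0 when N = 0. *)
Definition phi : tensor (Sym F N.-1) (ext N.+1 (Sym F d.+1)) ->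
                 tensor (ext N (Sym F d)) (Sym F d) :=
  tensor_lift phi_bilin.
HB.instance Definition _ := GRing.Linear.on phi.

Lemma phi_basis (s : 'I_N.-1.+1) (k : mindex d.+1 N.+1) : increasing k ->
  phi (tens (symX F s) (Fwedge k)) = phi_val s k.
Proof.
move=> k_incr; rewrite [LHS]tensor_liftE.
rewrite (bigD1 s) //= [X in _ + X]big1 ?addr0; last first.
  move=> s' s's; apply: big1 => k' _.
  by rewrite symcoefX eq_sym (negPf s's) mul0r scale0r.
rewrite (bigD1 k) //= big1 ?addr0 => [|k' /andP[k'_incr k'k]].
  by rewrite symcoefX ext_coordE // !eqxx mulr1 scale1r.
by rewrite ext_coordE // eq_sym (negPf k'k) mulr0 scale0r.
Qed.
End Phi.

Arguments phi F N d x : clear implicits, simpl never.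

Section Bases.
Variable F : fieldType.

Lemma sym_basis c (p : Sym F c) : p = \sum_i symcoef i p *: symX F i.
Proof.
apply/val_inj/mpolyP=> m /=; rewrite !raddf_sum /=.
under eq_bigr => i _ do rewrite mcoeffZ mcoeffX.
have [mc|mc] := eqVneq (mdeg m) c; last first.
  rewrite (dhomog_nemf_coeff (dhomog_is_dhomog p) mc) big1 // => i _.
  case: eqP => [im|_]; last by rewrite mulr0.
  by move: mc (symm_homog F i); rewrite dhomogX im => /negPf ->.
have m1c : (m ord_max < c.+1)%N.
  by rewrite ltnS -mc mdegE (bigD1 ord_max) //= leq_addr.
have m_symm : m = symm (Ordinal m1c).
  apply/mnmP => j; rewrite mnmE /= -mc mdegE !big_ord_recl big_ord0 addn0.
  have -> : fintype.lift ord0 ord0 = ord_max :> 'I_2 by apply: val_inj.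
  case: eqP => [->|/eqP]; first by rewrite addnK.
  by case: j => [[|[|//]] jlt] //= _; congr (m _); apply: val_inj.
rewrite (bigD1 (Ordinal m1c)) //= -m_symm eqxx mulr1 big1 ?addr0.
  by rewrite /symcoef -m_symm.
by move=> i im; rewrite [X in _ == X]m_symm (inj_eq (@symm_inj c)) (negPf im) mulr0.
Qed.

Lemma linear_sum_of (V W : lmodType F) (f : V -> W) (I : finType)
    (a : I -> F) (x : I -> V) : linear f ->
  f (\sum_i a i *: x i) = \sum_i a i *: f (x i).
Proof.
move=> f_lin; have f0 : f 0 = 0.
  apply: (@addrI _ (f 0)); move: (f_lin 1 0 0).
  by rewrite !scale1r addr0 => {1}<-; rewrite addr0.
elim/big_rec2: _ => [//|i _ y _ <-]; exact: f_lin.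
Qed.

Section Alternating.
Variables (r : nat) (V U : lmodType F) (h : {ffun 'I_r -> V} -> U).
Hypothesis h_alt : alternating h.

Lemma alternating_tperm (v : {ffun 'I_r -> V}) x y :
  h v = 0 -> h [ffun a => v (tperm x y a)] = 0.
Proof.
have [hl ha] := h_alt; move=> hv0.
have [->|xy] := eqVneq x y.
  by rewrite -hv0; congr h; apply/ffunP=> a; rewrite ffunE tperm1 perm1.
pose w p q := upd (upd v x p) y q.
have wxx p : h (w p p) = 0.
  by apply: (ha _ x y xy); rewrite !ffunE eqxx (negPf xy) eqxx.
have wC p q : upd (upd v y q) x p = w p q.
  apply/ffunP=> a; rewrite !ffunE.
  by have [->|//] := eqVneq a x; rewrite (negPf xy).
have wDr p q q' : h (w p (q + q')) = h (w p q) + h (w p q').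
  by have := hl (upd v x p) y 1 q q'; rewrite !scale1r.
have wDl p p' q : h (w (p + p') q) = h (w p q) + h (w p' q).
  by have := hl (upd v y q) x 1 p p'; rewrite !scale1r !wC.
have := wxx (v x + v y); rewrite wDr !wDl !wxx add0r addr0.
have -> : w (v x) (v y) = v.
  by apply/ffunP=> a; rewrite !ffunE; case: eqP => [->//|_]; case: eqP => [->|].
rewrite hv0 addr0 => <-; congr h; apply/ffunP=> a; rewrite !ffunE.
case: tpermP => [->|->|/eqP/negPf ax /eqP/negPf ay].
- by rewrite eqxx (negPf xy).
- by rewrite eqxx.
- by rewrite ax ay.
Qed.

Lemma alternating_perm (s : 'S_r) (v : {ffun 'I_r -> V}) :
  h v = 0 -> h [ffun a => v (s a)] = 0.
Proof.
have [ts -> _] := prod_tpermP s.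
elim: ts v => [|t ts IH] v hv0.
  by rewrite -hv0; congr h; apply/ffunP=> a; rewrite ffunE big_nil perm1.
have := alternating_tperm t.1 t.2 (IH v hv0).
by rewrite big_cons; congr (h _ = 0); apply/ffunP=> a; rewrite !ffunE permM.
Qed.
End Alternating.

Section SymAlternating.
Variables (c r : nat) (U : lmodType F) (h : {ffun 'I_r -> Sym F c} -> U).
Hypothesis h_alt : alternating h.
Hypothesis h_incr : forall i : mindex c r,
  increasing i -> h [ffun a => symX F (i a)] = 0.

Lemma alternating_symX0 (i : mindex c r) : h [ffun a => symX F (i a)] = 0.
Proof.
have [_ ha] := h_alt.
have [/injectiveP i_inj|/injectivePn[a [b ab iab]]] := boolP (injectiveb i);
  last by apply: (ha _ a b ab); rewrite !ffunE iab.
pose leI := fun x y : 'I_c.+1 => (x <= y)%N.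
have leI_tr : transitive leI by move=> y x z; apply: leq_trans.
pose t := [tuple i a | a < r].
have /tuple_permP[p tp] : perm_eq (sort_tuple leI t) t by rewrite perm_sort.
pose k : mindex c r := [ffun a => i (p a)].
have kE (a : 'I_r) : k a = tnth (sort_tuple leI t) a.
  by rewrite ffunE (tnth_nth ord0) [tval _]tp -tnth_nth !tnth_mktuple.
have k_incr : increasing k.
  apply/forallP=> a; apply/forallP=> b; apply/implyP=> ab.
  rewrite ltn_neqAle; apply/andP; split.
    rewrite !ffunE (inj_eq val_inj) (inj_eq i_inj) (inj_eq perm_inj).
    by rewrite -(inj_eq val_inj) /= ltn_eqF.
  rewrite !kE !(tnth_nth ord0).
  apply: (@sorted_ltn_nth _ leI) => //; rewrite ?inE ?size_tuple //.
  by apply: sort_sorted => x y; apply: leq_total.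
have := alternating_perm h_alt p^-1%g (h_incr k_incr).
by congr (h _ = 0); apply/ffunP=> a; rewrite !ffunE permKV.
Qed.

Lemma alternating_sym0 v : h v = 0.
Proof.
have [hl _] := h_alt.
have E m : (m <= r)%N -> forall (i : mindex c r),
    h [ffun a : 'I_r => if (a < m)%N then v a else symX F (i a)] = 0.
  elim: m => [_ i|m IH mr i].
    by rewrite -[RHS](alternating_symX0 i); congr h; apply/ffunP=> a; rewrite !ffunE.
  pose b := Ordinal mr.
  set w := [ffun _ => _].
  have -> : w = upd w b (\sum_j symcoef j (v b) *: symX F j).
    rewrite -sym_basis; apply/ffunP=> a; rewrite !ffunE.
    by case: eqP => [->|//]; rewrite ltnSn.
  rewrite (linear_sum_of _ _ (hl w b)) big1 // => j _.
  rewrite -[RHS](scaler0 _ (symcoef j (v b))); congr (_ *: _).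
  rewrite -[RHS](IH (ltnW mr) [ffun a => if a == b then j else i a]).
  congr h; apply/ffunP=> a; rewrite !ffunE ltnS.
  have [->|ab] := eqVneq a b; first by rewrite ltnn.
  by rewrite [(a <= m)%N]leq_eqVlt -[_ == m]/(val a == val b) (inj_eq val_inj) (negPf ab).
rewrite -[RHS](E r (leqnn r) [ffun=> ord0]); congr h.
by apply/ffunP=> a; rewrite ffunE ltn_ord.
Qed.
End SymAlternating.

Lemma ext_sym_ext c r (U : lmodType F) (f g : {linear ext r (Sym F c) -> U}) :
  (forall i : mindex c r, increasing i -> f (Fwedge F i) = g (Fwedge F i)) ->
  f =1 g.
Proof.
move=> fg; apply: ext_ext => v; apply/eqP; rewrite -subr_eq0; apply/eqP.
have [wl wa] := wedge_alternating r (Sym F c).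
apply: (@alternating_sym0 c r U (fun v => f (wedge v) - g (wedge v))).
  split=> [u i a x y|u i j ij uij]; last by rewrite (wa _ i j) // (linear0 f) (linear0 g) subrr.
  by rewrite wl (linearP f) (linearP g) scalerBr opprD addrACA.
by move=> i i_incr; rewrite fg ?subrr.
Qed.

Lemma phi_unique N d
    (f : {linear tensor (Sym F N.-1) (ext N.+1 (Sym F d.+1)) ->
                 tensor (ext N (Sym F d)) (Sym F d)}) :
  (forall (s : 'I_N.-1.+1) (k : mindex d.+1 N.+1), increasing k ->
     f (tens (symX F s) (Fwedge F k)) = phi_val F s k) ->
  f =1 phi F N d.
Proof.
move=> f_basis; apply: tensor_ext => p w.
have [tl _] := tens_bilin (Sym F N.-1) (ext N.+1 (Sym F d.+1)).
rewrite [p]sym_basis (linear_sum_of _ _ (tl w)) !linear_sum /=.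
apply: eq_bigr => s _; rewrite !linearZ /=; congr (_ *: _).
apply: (@ext_sym_ext _ _ _ (f \o tens (symX F s))
          (phi F N d \o tens (symX F s))) => k k_incr.
by rewrite /= f_basis ?phi_basis.
Qed.
End Bases.

(* Main.v *)
(* Loaded first, so that Sym denotes the symmetric power, not the symmetric group. *)
From mathcomp Require Import fingroup perm.
Require Import Defs.
From HB Require Import structures.
From mathcomp Require Import all_boot all_order all_algebra.
From mathcomp Require Import ring zify.
From mathcomp Require Import freeg mpoly.

(** Read elements of the exterior powers and tensor products as polynomial
    functions of points of F^2.  An element of ext r (Sym c) becomes the
    alternating function w(z_1, ..., z_r) with
    (v_1 /\ ... /\ v_r)(z) = det (v_a (z_b)),
    an element of the target becomes a function q(z_1, ..., z_N; y), and an
    element t = sum_s X^(N-1-s) Y^s (x) w_s of the source becomes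
    t(y; x_0, ..., x_N) = sum_s y_0^(N-1-s) y_1^s w_s(x).  With [z, y] the
    determinant of two points, the definition of phi amounts to
    << phi(t)(z; y) = +- t(y; z, y) / prod_c [z_c, y], >>
    because the sum over a box is a determinant of geometric sums, each
    geometric sum times [z_c, y] telescopes, and the resulting N x N determinant
    is what remains of the (N+1) x (N+1) alternant after clearing the column
    of y (phi_ev).  The sign is (-1)^b when y is put at place b among the points.

    Equivariance is now visible: SL2 acts by moving all points, and the bracket
    is invariant.  To conclude from an identity between functions, evaluate at the
    generic points x_c = (1, X_c), c = 0, ..., N, with coordinates in
    F[X_0, ..., X_N]: the alternants of basis vectors have distinct diagonal
    monomials, so this evaluation is injective (ext_gen_inj, target_gen_inj), and
    the field may be finite.

    Kernel and image come from interpolation at the N + 1 nodes X_b.  For q in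
    the target let P_b be (-1)^b times the value of q with y at place b, and put
    << H_q(T) = sum_b P_b prod_(c <> b) (X_c - T). >>
    Three facts about H_q (target_poly) carry the proof:
    - its value at X_b is P_b prod_(c <> b) [x_c, x_b], so H_(phi t) agrees with
      sum_s w_s(x) T^s at all nodes; both have degree at most N, hence are equal
      (target_poly_phi);
    - its coefficient of T^N is the value of the image of q in ext N.+1, by
      Laplace expansion (target_poly_coefN);
    - all its coefficients are values of elements of ext N.+1 (Sym d.+1), as H_q
      is a determinant with entries (X_c - T) v_a(x_c) (target_poly_coef_ev).
    By the first fact t is recovered from phi(t), and as H_(phi t) has degree less
    than N, the second puts phi(t) into the kernel of multiplication.  Conversely,
    if q is in this kernel then H_q has degree less than N, so by the third fact
    its coefficients define an element t, and phi(t) and q have the same H,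
    hence the same values. *)

Set Implicit Arguments.
Unset Strict Implicit.
Unset Printing Implicit Defensive.

Import GRing.Theory.
Local Open Scope ring_scope.

(** * Spanning sets of exterior powers and tensor products *)

(** Quotients of free modules are spanned by the classes of the generators. *)
Lemma lquot_free_ind (F : fieldType) (K : choiceType)
    (rel : {freeg K / F} -> Prop) (P : lquot rel -> Prop) :
  (forall a u v, P u -> P v -> P (a *: u + v)) -> P 0 ->
  (forall x, P (lquot_pi rel (fgen F x))) -> forall q, P q.
Proof.
move=> P_lin P0 Pgen q; rewrite -[q]lquot_piK -[repr q]freeg_sumE raddf_sum.
elim/big_rec: _ => [//|x y _ Py] /=.
set u := << _ *g _ >>; have -> : u = coeff x (repr q) *: fgen F x.
  by apply/eqP/freeg_eqP => z; rewrite coeffZ !coeffU mul1r.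
rewrite linearZ; apply: P_lin => //; exact: Pgen.
Qed.

Lemma tensor_ind (F : fieldType) (V W : lmodType F) (P : tensor V W -> Prop) :
  (forall a u v, P u -> P v -> P (a *: u + v)) ->
  (forall v w, P (tens v w)) -> forall q, P q.
Proof.
move=> P_lin Ptens; apply: lquot_free_ind => //; last by move=> -[v w]; apply: Ptens.
by have := P_lin (-1) _ _ (Ptens 0 0) (Ptens 0 0); rewrite scaleN1r addNr.
Qed.

Lemma tens_linearl (F : fieldType) (V W : lmodType F) (w : W) :
  linear (fun v : V => tens v w).
Proof. by case: (tens_bilin V W). Qed.

Lemma tens_suml (F : fieldType) (V W : lmodType F) (I : finType) (P : pred I)
    (v : I -> V) (w : W) :
  tens (\sum_(i | P i) v i) w = \sum_(i | P i) tens (v i) w.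
Proof.
have D v1 v2 : tens (v1 + v2) w = tens v1 w + tens v2 w.
  by have := tens_linearl w 1 v1 v2; rewrite !scale1r.
have Z0 : tens 0 w = 0 :> tensor V W.
  by apply: (@addrI _ (tens 0 w)); rewrite -D !addr0.
by elim/big_rec2: _ => [|i u x _ <-]; rewrite ?Z0 ?D.
Qed.

Lemma tensZl (F : fieldType) (V W : lmodType F) a (v : V) (w : W) :
  tens (a *: v) w = a *: tens v w.
Proof.
have -> : a *: v = a *: v + \sum_(i : 'I_0) 0 by rewrite big_ord0 addr0.
by rewrite tens_linearl tens_suml big_ord0 addr0.
Qed.

Lemma tensor_wedge_ind (F : fieldType) r (V W : lmodType F)
    (P : tensor (ext r V) W -> Prop) :
  (forall a u v, P u -> P v -> P (a *: u + v)) ->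
  (forall v w, P (tens (wedge v) w)) -> forall q, P q.
Proof.
move=> P_lin Pgen; apply: tensor_ind => // u w; move: u.
apply: lquot_free_ind => [a u v Pu Pv||v]; last exact: Pgen.
  by rewrite tens_linearl; apply: P_lin.
have -> : tens 0 w = (-1) *: tens (wedge 0) w + tens (wedge 0) w :> tensor (ext r V) W.
  by rewrite -tens_linearl scaleN1r addNr.
exact: P_lin.
Qed.

Lemma linear_eq_spanned (F : fieldType) (V W : lmodType F) (f g : {linear V -> W})
    (I : finType) (P : pred I) (a : I -> F) (v : I -> V) :
  (forall i, P i -> f (v i) = g (v i)) ->
  f (\sum_(i | P i) a i *: v i) = g (\sum_(i | P i) a i *: v i).
Proof.
by move=> fg; rewrite !linear_sum; apply: eq_bigr => i Pi; rewrite !linearZ fg.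
Qed.

Lemma tensor_repE (F : fieldType) (G : groupType) (V W : lmodType F)
    (rV : representation G V) (rW : representation G W) g v w :
  tensor_rep rV rW g (tens v w) = tens (rV g v) (rW g w).
Proof. exact: tensor_mapE. Qed.

Section ExteriorBasis.
Variables (F : fieldType) (r c : nat).

(** Kept as a linear map so that it can be compared with the identity on the
    basis. *)
Definition ext_expand (w : ext r (Sym F c)) : ext r (Sym F c) :=
  \sum_(k : mindex c r | increasing k) ext_coord k w *: Fwedge F k.

Fact ext_expand_linear : linear ext_expand.
Proof.
move=> a u v; rewrite /ext_expand scaler_sumr -big_split /=.
by apply: eq_bigr => k _; rewrite linearP scalerA -scalerDl.
Qed.

HB.instance Definition _ := GRing.isLinear.Build F _ _ _ ext_expand ext_expand_linear.

Lemma ext_expandE w : w = ext_expand w.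
Proof.
apply: (@ext_sym_ext _ _ _ _ idfun ext_expand) => i i_incr /=.
rewrite /ext_expand (bigD1 i) //= ext_coordE // eqxx scale1r big1 ?addr0 //.
by move=> k /andP[k_incr ki]; rewrite ext_coordE // eq_sym (negPf ki) scale0r.
Qed.

End ExteriorBasis.

Lemma tensor_sym_decomp (F : fieldType) (c : nat) (W : lmodType F)
    (t : tensor (Sym F c) W) :
  exists w : 'I_c.+1 -> W, t = \sum_s tens (symX F s) (w s).
Proof.
elim/tensor_ind: t => [a _ _ [u ->] [v ->]|p w].
  exists (fun s => a *: u s + v s); rewrite scaler_sumr -big_split /=.
  by apply: eq_bigr => s _; rewrite linearP.
exists (fun s => symcoef s p *: w); rewrite {1}[p]sym_basis tens_suml.
by apply: eq_bigr => s _; rewrite tensZl linearZ.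
Qed.

Lemma tensor_ext_decomp (F : fieldType) (N d : nat)
    (q : tensor (ext N (Sym F d)) (Sym F d)) :
  exists a : mindex d N * 'I_d.+1 -> F,
    q = \sum_(p | increasing p.1) a p *: Ften F p.1 p.2.
Proof.
elim/tensor_ind: q => [a _ _ [u ->] [v ->]|w f].
  exists (fun p => a * u p + v p); rewrite scaler_sumr -big_split /=.
  by apply: eq_bigr => p _; rewrite scalerA scalerDl.
exists (fun p => ext_coord p.1 w * symcoef p.2 f).
rewrite {1}[w]ext_expandE {1}[f]sym_basis tens_suml.
under eq_bigr => k _ do rewrite tensZl linear_sum scaler_sumr.
rewrite pair_big_dep /=; apply: eq_big => [p|p _]; first by rewrite andbT.
by rewrite linearZ scalerA.
Qed.

(** * Evaluation at points *)

Lemma det2 (R : comRingType) (A : 'M[R]_2) :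
  \det A = A ord0 ord0 * A ord_max ord_max - A ord0 ord_max * A ord_max ord0.
Proof.
rewrite (expand_det_row _ ord0) !big_ord_recl big_ord0 /cofactor !det_mx11 !mxE /=.
have E1 : fintype.lift ord0 ord0 = ord_max :> 'I_2 by apply: val_inj.
have E2 : fintype.lift ord_max ord0 = ord0 :> 'I_2 by apply: val_inj.
by rewrite !ord1 !E1 !E2 addr0 !expr1 !expr0 mul1r mulN1r mulrN.
Qed.

Section Evaluation.
Variables (F : fieldType) (n : nat).
Implicit Types (z y : 2.-tuple {mpoly F[n]}).

Definition sym_ev c z (p : Sym F c) : {mpoly F[n]} := val p \mPo z.

Fact sym_ev_linear c z : linear (@sym_ev c z).
Proof. by move=> a p q; rewrite /sym_ev /= linearP. Qed.

HB.instance Definition _ c z :=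
  GRing.isLinear.Build F (Sym F c) {mpoly F[n]} _ (@sym_ev c z) (@sym_ev_linear c z).

Lemma sym_ev_symX c z (i : 'I_c.+1) :
  sym_ev z (symX F i) = tnth z ord0 ^+ (c - i) * tnth z ord_max ^+ i.
Proof.
rewrite /sym_ev /= comp_mpolyX !big_ord_recl big_ord0 mulr1 !mnmE /=.
by congr (_ * tnth z _ ^+ _); apply: val_inj.
Qed.

Fact ext_ev_alternating r c (z : 'I_r -> 2.-tuple {mpoly F[n]}) : alternating
  (fun v : {ffun 'I_r -> Sym F c} =>
     \det (\matrix_(a, b) sym_ev (z b) (v a)) : {mpoly F[n]}).
Proof.
split=> [v i a x y|v i j ij vij]; last first.
  by apply: (determinant_alternate ij) => b; rewrite !mxE vij.
rewrite -mul_mpolyC -[\det _ in X in _ = _ + X]mul1r.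
apply: (@determinant_multilinear _ _ _ _ _ i) => /=.
- by apply/rowP=> b; rewrite !mxE !ffunE !eqxx linearP mul1r mul_mpolyC.
- apply/matrixP=> u b; rewrite !mxE !ffunE.
  by rewrite eq_sym (negPf (neq_lift _ _)).
- apply/matrixP=> u b; rewrite !mxE !ffunE.
  by rewrite eq_sym (negPf (neq_lift _ _)).
Qed.

Definition ext_ev r c (z : 'I_r -> 2.-tuple {mpoly F[n]}) :
  ext r (Sym F c) -> {mpoly F[n]} := ext_lift (ext_ev_alternating c z).
HB.instance Definition _ r c (z : 'I_r -> 2.-tuple {mpoly F[n]}) :=
  GRing.Linear.on (@ext_ev r c z).

Lemma ext_evE r c (z : 'I_r -> 2.-tuple {mpoly F[n]}) (v : {ffun 'I_r -> Sym F c}) :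
  ext_ev z (wedge v) = \det (\matrix_(a, b) sym_ev (z b) (v a)).
Proof. exact: (ext_liftE (ext_ev_alternating c z)). Qed.

Lemma ext_ev_Fwedge r c (z : 'I_r -> 2.-tuple {mpoly F[n]}) (i : mindex c r) :
  ext_ev z (Fwedge F i) = \det (\matrix_(a, b) sym_ev (z b) (symX F (i a))).
Proof. by rewrite ext_evE; congr (\det _); apply/matrixP => a b; rewrite !mxE ffunE. Qed.

Section Tensor.
Variables (V W : lmodType F) (f : {linear V -> {mpoly F[n]}})
  (g : {linear W -> {mpoly F[n]}}).

Fact tensor_ev_bilin : bilin (fun v w => f v * g w : {mpoly F[n]}).
Proof.
split=> [w a u v|v a u w] /=; rewrite linearP.
  by rewrite mulrDl scalerAl.
by rewrite mulrDr scalerAr.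
Qed.

Definition tensor_ev : tensor V W -> {mpoly F[n]} := tensor_lift tensor_ev_bilin.
HB.instance Definition _ := GRing.Linear.on tensor_ev.

Lemma tensor_evE v w : tensor_ev (tens v w) = f v * g w.
Proof. exact: (tensor_liftE tensor_ev_bilin). Qed.
End Tensor.

(** Right action, so that evaluation at z after acting by g is evaluation at z g. *)
Definition pt_act z (g : SL2 F) : 2.-tuple {mpoly F[n]} :=
  [tuple \sum_(i < 2) (g : 'M_2) i j *: tnth z i | j < 2].

Lemma sym_ev_act c z (g : SL2 F) (p : Sym F c) :
  sym_ev z (sym_rep F c g p) = sym_ev (pt_act z g) p.
Proof.
rewrite /sym_ev /= (comp_mpolyE _ (sym_subst g)) (comp_mpolyE _ (pt_act z g)) raddf_sum /=.
apply: eq_bigr => m _; rewrite comp_mpolyZ rmorph_prod /=; congr (_ *: _).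
apply: eq_bigr => j _; rewrite rmorphXn /=; congr (_ ^+ _).
rewrite !tnth_mktuple raddf_sum /=; apply: eq_bigr => i _.
by rewrite comp_mpolyZ comp_mpolyXU -tnth_nth.
Qed.

Lemma ext_ev_act r c (z : 'I_r -> 2.-tuple {mpoly F[n]}) (g : SL2 F)
    (w : ext r (Sym F c)) :
  ext_ev z (ext_rep r (sym_rep F c) g w) = ext_ev (fun b => pt_act (z b) g) w.
Proof.
pose h := ext_ev z \o ext_rep r (sym_rep F c) g.
apply: (@ext_ext _ _ _ _ h (ext_ev (fun b => pt_act (z b) g))) => v.
rewrite /h /= ext_mapE !ext_evE; congr (\det _); apply/matrixP => a b.
by rewrite !mxE ffunE sym_ev_act.
Qed.

Lemma pt_actE z (g : SL2 F) j : tnth (pt_act z g) j =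
  ((g : 'M_2) ord0 j)%:MP * tnth z ord0 + ((g : 'M_2) ord_max j)%:MP * tnth z ord_max.
Proof.
rewrite tnth_mktuple !big_ord_recl big_ord0 addr0 -!mul_mpolyC.
by have -> : fintype.lift ord0 ord0 = ord_max :> 'I_2 by apply: val_inj.
Qed.

(** The invariant area form; its sign is the one that turns generic points into
    X_c - X_b. *)
Definition bracket z y : {mpoly F[n]} :=
  tnth z ord_max * tnth y ord0 - tnth z ord0 * tnth y ord_max.

Lemma bracket_act z y (g : SL2 F) : bracket (pt_act z g) (pt_act y g) = bracket z y.
Proof.
have /(congr1 (@mpolyC n F)) := det2 g; rewrite SL2_det mpolyC1 rmorphB !rmorphM /= => det1.
by rewrite /bracket !pt_actE -[RHS]mul1r det1; ring.
Qed.

End Evaluation.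

(** * Determinants *)

Section Determinants.
Variable R : comNzRingType.

Lemma det_sum_family n (J : finType) (Q : 'I_n -> pred J) (G : 'I_n -> J -> 'I_n -> R) :
  \det (\matrix_(a, c) \sum_(i | Q a i) G a i c)
  = \sum_(f in family Q) \det (\matrix_(a, c) G a (f a) c).
Proof.
rewrite /determinant exchange_big /=; apply: eq_bigr => s _.
under eq_bigr => a _ do rewrite mxE.
rewrite bigA_distr_big_dep big_distrr /=; apply: eq_bigr => f _.
by congr (_ * _); apply: eq_bigr => a _; rewrite mxE.
Qed.

Lemma det_scale_rows n (r : 'I_n -> R) (G : 'I_n -> 'I_n -> R) :
  \det (\matrix_(a, c) (r a * G a c)) = (\prod_a r a) * \det (\matrix_(a, c) G a c).
Proof.
transitivity (\det (diag_mx (\row_a r a) *m \matrix_(a, c) G a c)).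
  by congr (\det _); apply/matrixP => a c; rewrite mul_diag_mx !mxE.
by rewrite det_mulmx det_diag; congr (_ * _); apply: eq_bigr => a _; rewrite mxE.
Qed.

Lemma det_scale_cols n (r : 'I_n -> R) (G : 'I_n -> 'I_n -> R) :
  \det (\matrix_(a, c) (G a c * r c)) = \det (\matrix_(a, c) G a c) * \prod_c r c.
Proof.
rewrite -det_tr mulrC -[\det (\matrix_(_, _) G _ _)]det_tr.
transitivity (\det (\matrix_(c, a) (r c * G a c))).
  by congr (\det _); apply/matrixP => a c; rewrite !mxE mulrC.
rewrite det_scale_rows; congr (_ * \det _).
by apply/matrixP => a c; rewrite !mxE.
Qed.

(** The numerator and denominator of a geometric sum in x' / x against u' / u,
    homogenized to avoid fractions. *)
Lemma geometric_bracket (d k l : nat) (x x' u u' : R) : (k <= l)%N -> (l <= d.+1)%N ->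
  (\sum_(i < d.+1 | (k <= i < l)%N)
     x ^+ (d - i) * x' ^+ i * (u ^+ (i - k) * u' ^+ (l.-1 - i))) * (x' * u - x * u')
  = u ^+ (l - k) * (x ^+ (d.+1 - l) * x' ^+ l) - u' ^+ (l - k) * (x ^+ (d.+1 - k) * x' ^+ k).
Proof.
move=> kl ld.
pose f i := x ^+ (d.+1 - i) * x' ^+ i * (u ^+ (i - k) * u' ^+ (l - i)).
have -> : \sum_(i < d.+1 | (k <= i < l)%N)
      x ^+ (d - i) * x' ^+ i * (u ^+ (i - k) * u' ^+ (l.-1 - i))
    = \sum_(k <= i < l) x ^+ (d - i) * x' ^+ i * (u ^+ (i - k) * u' ^+ (l.-1 - i)).
  by rewrite (big_nat_widenl _ 0) // (big_nat_widen _ _ _ _ _ ld) big_mkord.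
rewrite big_distrl /=.
transitivity (\sum_(k <= i < l) (f i.+1 - f i)).
  apply: eq_big_nat => i /andP[ki il]; rewrite /f subSS.
  have -> : (l.-1 - i = l - i.+1)%N by lia.
  have -> : (d.+1 - i = (d - i).+1)%N by lia.
  have -> : (i.+1 - k = (i - k).+1)%N by lia.
  have -> : (l - i = (l - i.+1).+1)%N by lia.
  by rewrite !exprS; ring.
by rewrite telescope_sumr // /f !subnn !expr0; ring.
Qed.

End Determinants.

Lemma inord_lift N (a : 'I_N) : inord a.+1 = fintype.lift ord0 a.
Proof. by apply: val_inj; rewrite /= inordK // ltnS. Qed.

Lemma inord_widen N (a : 'I_N) : inord a = widen_ord (leqnSn N) a.
Proof. by apply: val_inj; rewrite /= inordK // ltnS ltnW. Qed.

Section Bidiagonal.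
(* The points are (x c, x' c), and b is the place of the point y. *)
Variables (R : idomainType) (N D : nat) (b : 'I_N.+1).
Variables (x x' : 'I_N.+1 -> R) (k : 'I_N.+1 -> nat).
Hypothesis u_neq0 : x b != 0.
Hypothesis kD : forall a, (k a <= D)%N.
Hypothesis k_homo : forall a : 'I_N, (k (widen_ord (leqnSn N) a) <= k (fintype.lift ord0 a))%N.

Let m (a c : 'I_N.+1) := x c ^+ (D - k a) * x' c ^+ k a.
Let step (a : 'I_N) := (k (fintype.lift ord0 a) - k (widen_ord (leqnSn N) a))%N.
Let elim_row (a : 'I_N) c :=
  x b ^+ step a * m (fintype.lift ord0 a) c - x' b ^+ step a * m (widen_ord (leqnSn N) a) c.

(** The row combinations in elim_row are chosen to clear column b. *)
Lemma elim_row_col a : elim_row a b = 0.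
Proof.
have h := k_homo a; have h' := kD (fintype.lift ord0 a).
rewrite /elim_row /m /step; set l := k (fintype.lift _ _) in h h' *; set j := k _ in h *.
have -> : (D - j = (D - l) + (l - j))%N by lia.
have -> : l = (j + (l - j))%N by lia.
have -> : (j + (l - j) - j = l - j)%N by lia.
by rewrite !exprD; ring.
Qed.

Lemma sum_step : (\sum_a step a = k ord_max - k ord0)%N.
Proof.
have -> : (\sum_a step a = \sum_(0 <= a < N) (k (inord a.+1) - k (inord a)))%N.
  by rewrite big_mkord; apply: eq_bigr => a _; rewrite inord_lift inord_widen.
rewrite telescope_sumn_in // => [|a /andP[_ aN]].
  by congr (k _ - k _)%N; apply: val_inj; rewrite /= inordK.
by have := k_homo (Ordinal aN); rewrite -inord_lift -inord_widen.
Qed.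

(** A bidiagonal triangular matrix L performs the row operations elim_row and
    keeps row 0.  After them column b is zero below row 0, so expanding along it
    leaves the smaller determinant; det L is a power of x b, which is cancelled
    on both sides. *)
Lemma det_bidiagonal :
  (-1) ^+ b * (x b ^+ (D - k ord_max) * x' b ^+ k ord0
    * \det (\matrix_(a, c) elim_row a (fintype.lift b c)))
  = \det (\matrix_(a, c) m a c).
Proof.
pose M := \matrix_(a, c) m a c.
pose L : 'M[R]_N.+1 := \matrix_(a, a') if unlift ord0 a is Some a1 then
  (a' == fintype.lift ord0 a1)%:R * x b ^+ step a1
  - (a' == widen_ord (leqnSn N) a1)%:R * x' b ^+ step a1 else (a' == ord0)%:R.
have L_trig : is_trig_mx L.
  apply/is_trig_mxP => a a' aa'; rewrite mxE; case: unliftP aa' => [a1 ->|->] aa'.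
    have [e1|_] := eqVneq a'; first by rewrite e1 ltnn in aa'.
    have [e1|_] := eqVneq a'; last by rewrite !mul0r subr0.
    by move: aa'; rewrite e1 /= /bump /=; lia.
  by have [e1|//] := eqVneq a'; rewrite e1 in aa'.
have detL : \det L = x b ^+ (k ord_max - k ord0).
  rewrite (det_trig L_trig) big_ord_recl mxE unlift_none eqxx mul1r -sum_step.
  rewrite -prodrXr; apply: eq_bigr => a _; rewrite mxE liftK eqxx mul1r.
  have [e1|_] := eqVneq; last by rewrite mul0r subr0.
  by move/(congr1 val): e1; rewrite /= /bump /=; lia.
have LM0 c : (L *m M) ord0 c = m ord0 c.
  rewrite mxE (bigD1 ord0) //= !mxE unlift_none eqxx mul1r big1 ?addr0 // => a a0.
  by rewrite !mxE unlift_none (negPf a0) mul0r.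
have LMS a c : (L *m M) (fintype.lift ord0 a) c = elim_row a c.
  rewrite mxE; under eq_bigr => a' _ do rewrite !mxE liftK mulrBl -!mulrA !mulr_natl.
  rewrite sumrB; congr (_ - _).
    by rewrite (bigD1 (fintype.lift ord0 a)) //= eqxx big1 ?addr0 // => a' /negPf ->.
  by rewrite (bigD1 (widen_ord (leqnSn N) a)) //= eqxx big1 ?addr0 // => a' /negPf ->.
have := det_mulmx L M; rewrite (expand_det_col _ b) big_ord_recl big1 ?addr0 => [|a _]; last first.
  by rewrite LMS elim_row_col mul0r.
rewrite detL LM0 /cofactor add0n.
have -> : row' ord0 (col' b (L *m M)) = \matrix_(a, c) elim_row a (fintype.lift b c).
  by apply/matrixP => a c; rewrite [LHS]mxE [LHS]mxE LMS mxE.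
move=> E; apply: (@mulfI _ (x b ^+ (k ord_max - k ord0))); first exact: expf_neq0.
have k0max : (k ord0 <= k ord_max)%N.
  have H j : (j < N.+1)%N -> (k ord0 <= k (inord j))%N.
    elim: j => [_|j IH jN].
      by apply: eq_leq; congr k; apply: val_inj; rewrite /= inordK.
    apply: leq_trans (IH (ltnW jN)) _.
    by have := k_homo (Ordinal (jN : (j < N)%N)); rewrite -inord_lift -inord_widen.
  by have := H N (ltnSn N); congr (_ <= k _)%N; apply: val_inj; rewrite /= inordK.
rewrite -E /m; have -> : (D - k ord0 = (k ord_max - k ord0) + (D - k ord_max))%N.
  by have := kD ord_max; lia.
by rewrite exprD; ring.
Qed.

End Bidiagonal.

(** * The quotient formula for phi *)

Section PhiEvaluation.
Variables (F : fieldType) (N d n : nat).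
Implicit Types (x : 'I_N.+1 -> 2.-tuple {mpoly F[n]}) (b : 'I_N.+1).

(** The values of an element of the target and of the source of phi, with x b as
    the distinguished point y.  In the source y also occurs as argument b of the
    alternating factor. *)
Definition target_ev x b : tensor (ext N (Sym F d)) (Sym F d) -> {mpoly F[n]} :=
  tensor_ev (ext_ev (fun c => x (fintype.lift b c))) (sym_ev (x b)).
HB.instance Definition _ x b := GRing.Linear.on (target_ev x b).

Definition source_ev x b :
    tensor (Sym F N.-1) (ext N.+1 (Sym F d.+1)) -> {mpoly F[n]} :=
  tensor_ev (sym_ev (x b)) (ext_ev x).
HB.instance Definition _ x b := GRing.Linear.on (source_ev x b).

Definition bracket_prod x b := \prod_c bracket (x (fintype.lift b c)) (x b).

(** The exponents d - j and j of the last tensor factor split into a part that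
    depends on i one index at a time, and a part that only depends on s and the
    outer entries of k.  This is what makes the sum over the box a product. *)
Lemma box_exponents (k : mindex d.+1 N.+1) (i : mindex d N) s :
  (s < N)%N -> i \in box k ->
  let j := (s + weight k - N - weight i)%N in
  [/\ (j <= d)%N,
   j = (s + k ord0 + \sum_(a < N) ((k (fintype.lift ord0 a)).-1 - i a))%N &
   (d - j = (N.-1 - s) + (d.+1 - k ord_max)
     + \sum_(a < N) (i a - k (widen_ord (leqnSn N) a)))%N].
Proof.
move=> sN ik; have := box_bounds sN ik; move: ik; rewrite inE => /forallP ik.
have E1 : (\sum_(a < N) ((k (fintype.lift ord0 a)).-1 - i a) + weight i + N
    = \sum_(a < N) k (fintype.lift ord0 a))%N.
  rewrite -[X in (_ + X)%N](card_ord N) -sum1_card -!big_split /=.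
  by apply: eq_bigr => a _; have := ik a; lia.
have E2 : (\sum_(a < N) (i a - k (widen_ord (leqnSn N) a))
    + \sum_(a < N) k (widen_ord (leqnSn N) a) = weight i)%N.
  by rewrite -big_split /=; apply: eq_bigr => a _; have := ik a; lia.
have W1 : weight k = (k ord0 + \sum_(a < N) k (fintype.lift ord0 a))%N.
  by rewrite /weight big_ord_recl.
have W2 : weight k = (\sum_(a < N) k (widen_ord (leqnSn N) a) + k ord_max)%N.
  by rewrite /weight big_ord_recr.
have kd := ltn_ord (k ord_max).
by move=> /andP[lo hi] j; split; rewrite ?/j; lia.
Qed.

(** Distribute the last tensor factor over the rows: the box sum becomes a
    determinant of geometric sums.  Multiplying its columns by the brackets
    telescopes the entries to differences of two monomials, to which
    det_bidiagonal applies. *)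
Lemma phi_val_ev x b (s : 'I_N.-1.+1) (k : mindex d.+1 N.+1) :
  (0 < N)%N -> increasing k -> tnth (x b) ord0 != 0 ->
  (-1) ^+ b * target_ev x b (phi_val F s k) * bracket_prod x b
  = source_ev x b (tens (symX F s) (Fwedge F k)).
Proof.
move=> N_gt0 k_incr u_neq0.
pose u := tnth (x b) ord0; pose u' := tnth (x b) ord_max.
pose klo a := k (widen_ord (leqnSn N) a); pose khi a := k (fintype.lift ord0 a).
have k_homo a : (klo a <= khi a)%N.
  move/forallP: k_incr => /(_ (widen_ord (leqnSn N) a)) /forallP /(_ (fintype.lift ord0 a)).
  by move/implyP/(_ (ltnSn _))/ltnW.
have sN : (s < N)%N by have := ltn_ord s; lia.
pose G a (i : 'I_d.+1) (c : 'I_N) := sym_ev (x (fintype.lift b c)) (symX F i)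
  * (u ^+ (i - klo a) * u' ^+ ((khi a).-1 - i)).
have -> : target_ev x b (phi_val F s k)
    = u ^+ (N.-1 - s + (d.+1 - k ord_max)) * u' ^+ (s + k ord0)
      * \det (\matrix_(a, c) \sum_(i < d.+1 | (klo a <= i < khi a)%N) G a i c).
  rewrite det_sum_family raddf_sum /= big_distrr /=.
  apply: eq_big => [i|i ik].
    by rewrite inE; apply/forallP/familyP.
  have [jd Ej Edj] := box_exponents sN ik.
  rewrite /target_ev /Ften tensor_evE /= ext_ev_Fwedge sym_ev_symX inordK //.
  rewrite Edj Ej !exprD -/u -/u' -!prodrXr.
  have -> : \det (\matrix_(a, c) G a (i a) c)
      = (\prod_a (u ^+ (i a - klo a) * u' ^+ ((khi a).-1 - i a)))
        * \det (\matrix_(a, c) sym_ev (x (fintype.lift b c)) (symX F (i a))).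
    by rewrite -det_scale_rows; congr (\det _); apply/matrixP => a c; rewrite !mxE mulrC.
  rewrite big_split /=.
  by rewrite /klo /khi; ring.
rewrite /source_ev tensor_evE /= ext_ev_Fwedge sym_ev_symX -/u -/u'.
have -> : (\matrix_(a, c) sym_ev (x c) (symX F (k a)))
  = \matrix_(a, c) (tnth (x c) ord0 ^+ (d.+1 - k a) * tnth (x c) ord_max ^+ k a).
  by apply/matrixP => a c; rewrite !mxE sym_ev_symX.
rewrite -(@det_bidiagonal _ N d.+1 b (fun c => tnth (x c) ord0) (fun c => tnth (x c) ord_max)
  (fun a => k a)) //; last by move=> a; rewrite -ltnS.
rewrite -/u -/u' -!mulrA -det_scale_cols !exprD.
set A := \det _; set B := \det _; suff -> : A = B by ring.
congr (\det _); apply/matrixP => a c; rewrite !mxE.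
rewrite -geometric_bracket; [|exact: k_homo|by rewrite -ltnS].
by congr (_ * _); apply: eq_bigr => i _; rewrite /G sym_ev_symX.
Qed.

(** The linear extension of phi_val_ev: phi divides by the product of the brackets. *)
Lemma phi_ev x b t : (0 < N)%N -> tnth (x b) ord0 != 0 ->
  (-1) ^+ b * target_ev x b (phi F N d t) * bracket_prod x b = source_ev x b t.
Proof.
move=> N_gt0 u_neq0.
pose f : {linear _ -> _} := ((-1) ^+ b * bracket_prod x b) \*o (target_ev x b \o phi F N d).
suff : f t = source_ev x b t by move=> <-; rewrite /f /= mulrAC.
have [w ->] := tensor_sym_decomp t.
rewrite !linear_sum; apply: eq_bigr => s _; rewrite [w s]ext_expandE /ext_expand.
apply: (@linear_eq_spanned _ _ _ (f \o tens (symX F s))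
  (source_ev x b \o tens (symX F s))) => k k_incr.
by rewrite /= mulrAC phi_basis // phi_val_ev.
Qed.

Lemma target_ev_act x b (g : SL2 F) q :
  target_ev x b (tensor_rep (ext_rep N (sym_rep F d)) (sym_rep F d) g q)
  = target_ev (fun c => pt_act (x c) g) b q.
Proof.
elim/tensor_ind: q => [a q q' Eq Eq'|w f]; first by rewrite !linearP /= Eq Eq'.
have targetE y v h : target_ev y b (tens v h)
    = ext_ev (fun c => y (fintype.lift b c)) v * sym_ev (y b) h by exact: tensor_evE.
by rewrite tensor_repE targetE ext_ev_act sym_ev_act targetE.
Qed.

Lemma source_ev_act x b (g : SL2 F) t :
  source_ev x b (tensor_rep (sym_rep F N.-1) (ext_rep N.+1 (sym_rep F d.+1)) g t)
  = source_ev (fun c => pt_act (x c) g) b t.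
Proof.
elim/tensor_ind: t => [a t t' Et Et'|f w]; first by rewrite !linearP /= Et Et'.
rewrite tensor_repE /source_ev !tensor_evE /=.
by rewrite ext_ev_act sym_ev_act.
Qed.

Lemma bracket_prod_act x b (g : SL2 F) :
  bracket_prod (fun c => pt_act (x c) g) b = bracket_prod x b.
Proof. by apply: eq_bigr => c _; apply: bracket_act. Qed.

(** Laplace expansion along the last row, which holds the vector appended by snoc. *)
Lemma mulwedge_ev x (q : tensor (ext N (Sym F d)) (Sym F d)) :
  ext_ev x (mulwedge q) = (-1) ^+ N * \sum_(b < N.+1) (-1) ^+ b * target_ev x b q.
Proof.
elim/tensor_wedge_ind: q => [a q q' Eq Eq'|v f].
  rewrite !linearP /= Eq Eq' scalerAr scaler_sumr -mulrDr -big_split /=.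
  by congr (_ * _); apply: eq_bigr => b _; rewrite linearP mulrDr scalerAr.
rewrite mulwedgeE ext_evE (expand_det_row _ ord_max) mulr_sumr.
apply: eq_bigr => b _; rewrite /target_ev tensor_evE /= ext_evE /cofactor exprD.
rewrite mxE ffunE unlift_none /=.
have -> : row' ord_max (col' b (\matrix_(a, c) sym_ev (x c) (snoc v f a)))
    = \matrix_(a, c) sym_ev (x (fintype.lift b c)) (v a).
  by apply/matrixP => a c; rewrite !mxE ffunE liftK.
by ring.
Qed.

End PhiEvaluation.

(** * Polynomials through N + 1 nodes *)

Section Lagrange.
Variables (R : comNzRingType) (N : nat) (x : 'I_N.+1 -> R).
Implicit Types (P : 'I_N.+1 -> R) (b : 'I_N.+1).

(** Lagrange interpolation without denominators: the value at x b is P b times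
    the product of the differences to x b. *)
Definition nodal_sum P : {poly R} :=
  \sum_(b < N.+1) P b *: \prod_(c < N) ((x (fintype.lift b c))%:P - 'X).

Lemma nodal_monic b : \prod_(c < N) ('X - (x (fintype.lift b c))%:P) \is monic.
Proof. exact: monic_prod_XsubC. Qed.

Lemma size_nodal b : size (\prod_(c < N) ('X - (x (fintype.lift b c))%:P)) = N.+1.
Proof. by rewrite size_prod_XsubC /index_enum -enumT size_enum_ord. Qed.

Lemma nodal_opp b : \prod_(c < N) ((x (fintype.lift b c))%:P - 'X)
  = (-1) ^+ N *: \prod_(c < N) ('X - (x (fintype.lift b c))%:P).
Proof.
rewrite -mul_polyC rmorph_sign; have -> : (-1) ^+ N = \prod_(c < N) (-1 : {poly R}).
  by rewrite prodr_const card_ord.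
by rewrite -big_split; apply: eq_bigr => c _; rewrite /= mulN1r opprB.
Qed.

Lemma size_nodal_sum P : (size (nodal_sum P) <= N.+1)%N.
Proof.
apply: (leq_trans (size_sum _ _ _)); apply/bigmax_leqP => b _.
by rewrite nodal_opp scalerA (leq_trans (size_scale_leq _ _)) // size_nodal.
Qed.

Lemma nodal_sum_coef P : (nodal_sum P)`_N = (-1) ^+ N * \sum_b P b.
Proof.
rewrite coef_sum mulr_sumr; apply: eq_bigr => b _.
have /monicP := nodal_monic b; rewrite lead_coefE size_nodal nodal_opp !coefZ /= => ->.
by rewrite mulr1 mulrC.
Qed.

Lemma nodal_sum_horner P b :
  (nodal_sum P).[x b] = P b * \prod_(c < N) (x (fintype.lift b c) - x b).
Proof.
rewrite horner_sum (bigD1 b) //= [X in _ + X]big1 ?addr0 => [|b' b'b]; rewrite hornerZ horner_prod.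
  by congr (_ * _); apply: eq_bigr => c _; rewrite !hornerE.
have [c bc|bb'] := unliftP b' b; last by rewrite bb' eqxx in b'b.
by rewrite (bigD1 c) //= -bc hornerD hornerN hornerC hornerX subrr mul0r mulr0.
Qed.

End Lagrange.

Section Pencil.
Variable R : comNzRingType.

(** Choose A or X B in every row. *)
Lemma det_pencil r (A B : 'I_r -> 'I_r -> R) :
  \det (\matrix_(a, c) ((A a c)%:P + 'X * (B a c)%:P))
  = \sum_(J : {set 'I_r})
      (\det (\matrix_(a, c) if a \in J then B a c else A a c)) *: 'X^#|J|.
Proof.
transitivity (\sum_(J : {set 'I_r})
    \det (\matrix_(a, c) ((if a \in J then 'X else 1) * (if a \in J then B a c else A a c)%:P))).
  rewrite /determinant exchange_big; apply: eq_bigr => s _ /=.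
  under eq_bigr => a _ do rewrite mxE addrC.
  rewrite bigA_distr big_distrr; apply: eq_bigr => J _ /=; congr (_ * _).
  by apply: eq_bigr => a _; rewrite mxE; case: ifP => _ //; rewrite mul1r.
apply: eq_bigr => J _; rewrite det_scale_rows -big_mkcond /= prodr_const mulrC -mul_polyC.
congr (_ * _); rewrite -det_map_mx; congr (\det _).
by apply/matrixP => a c; rewrite !mxE.
Qed.

Variables (N : nat) (x : 'I_N.+1 -> R) (A : 'I_N -> 'I_N.+1 -> R) (f : 'I_N.+1 -> R).

Let A1 a c := oapp (fun a1 => x c * A a1 c) (f c) (unlift (@ord_max N) a).
Let A2 a c := oapp (fun a1 => - A a1 c) 0 (unlift (@ord_max N) a).

(** Laplace expansion along the last row.  The factor (x c - T) of column c is
    distributed over the entries of the other rows, so that every entry is of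
    degree one in T. *)
Lemma nodal_sum_det :
  nodal_sum x (fun b => (-1) ^+ b * (\det (\matrix_(a, c) A a (fintype.lift b c)) * f b))
  = (-1) ^+ N *: \det (\matrix_(a, c) ((A1 a c)%:P + 'X * (A2 a c)%:P)).
Proof.
rewrite (expand_det_row _ ord_max) scaler_sumr; apply: eq_bigr => b _.
rewrite mxE /A1 /A2 unlift_none /= mulr0 addr0 /cofactor.
have -> : row' ord_max (col' b (\matrix_(a, c) ((A1 a c)%:P + 'X * (A2 a c)%:P)))
    = \matrix_(a, c) ((A a (fintype.lift b c))%:P * ((x (fintype.lift b c))%:P - 'X)).
  apply/matrixP => a c; rewrite !mxE /A1 /A2 liftK /= polyCM polyCN.
  by ring.
rewrite det_scale_cols.
have -> : \det (\matrix_(a, c) (A a (fintype.lift b c))%:P)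
    = (\det (\matrix_(a, c) A a (fintype.lift b c)))%:P.
  by rewrite -det_map_mx; congr (\det _); apply/matrixP => a c; rewrite !mxE.
rewrite -!mul_polyC !polyCM !rmorph_sign /= exprD.
set fb := (f b)%:P; set D := (\det _)%:P; set Q := \prod_c _.
have -> : (-1) ^+ N * (fb * ((-1) ^+ N * (-1) ^+ b * (D * Q)))
    = (-1) ^+ N * ((-1) ^+ N * ((-1) ^+ b * (D * fb) * Q)) by ring.
by rewrite signrMK.
Qed.

Lemma nodal_sum_coef_det s :
  (nodal_sum x (fun b => (-1) ^+ b * (\det (\matrix_(a, c) A a (fintype.lift b c)) * f b)))`_s
  = (-1) ^+ N * \sum_(J : {set 'I_N.+1} | #|J| == s)
      \det (\matrix_(a, c) if a \in J then A2 a c else A1 a c).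
Proof.
rewrite nodal_sum_det det_pencil coefZ coef_sum; congr (_ * _).
rewrite [RHS]big_mkcond; apply: eq_bigr => J _.
by rewrite coefZ coefXn eq_sym; case: eqP => _; rewrite ?mulr1 ?mulr0.
Qed.

End Pencil.

(** * The generic point *)

Section Alternants.
Variables (F : fieldType) (n r c : nat).

Definition expo (j : 'I_r -> 'I_n) (i : mindex c r) : 'X_{1..n} :=
  (\sum_(b < r) U_(j b) *+ i b)%MM.

Lemma expoE (j : 'I_r -> 'I_n) i b : injective j -> expo j i (j b) = i b.
Proof.
move=> j_inj; rewrite mnm_sumE (bigD1 b) //= mulmnE mnm1E eqxx mul1n big1 ?addn0 //.
by move=> b' b'b; rewrite mulmnE mnm1E (inj_eq j_inj) (negPf b'b).
Qed.

(** In the Leibniz formula the term of s is a monomial with exponent i a at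
    the variable j (s a).  For increasing i and k this is the diagonal exponent of k
    only if i = k and s = 1.  The monomials m and m', in the variables
    outside the image of j, account for the last tensor factor. *)
Lemma alternant_coef (j : 'I_r -> 'I_n) (i k : mindex c r) (m m' : 'X_{1..n}) :
  injective j -> (forall b, m (j b) = 0%N) -> (forall b, m' (j b) = 0%N) ->
  increasing i -> increasing k ->
  (\det (\matrix_(a, b) 'X_(j b) ^+ i a) * 'X_[F, m])@_(expo j k + m')
  = ((i == k) && (m == m'))%:R.
Proof.
move=> j_inj m0 m'0 i_incr k_incr.
have E (s : 'S_r) : ((-1) ^+ s * \prod_a (\matrix_(a, b) 'X_(j b) ^+ i a) a (s a)
      * 'X_[F, m])@_(expo j k + m')
    = (-1) ^+ s * ((expo (j \o s) i + m)%MM == (expo j k + m')%MM)%:R.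
  have -> : \prod_a (\matrix_(a, b) 'X_(j b) ^+ i a) a (s a) = 'X_[F, expo (j \o s) i].
    by rewrite /expo -mprodXnE; apply: eq_bigr => a _; rewrite mxE.
  rewrite -mulrA -mpolyXD; have -> : (-1) ^+ s = ((-1) ^+ s)%:MP_[n] :> {mpoly F[n]}.
    by rewrite rmorph_sign.
  by rewrite mcoeffCM mcoeffX.
rewrite /determinant mulr_suml raddf_sum (eq_bigr _ (fun s _ => E s)).
(* Only the identity permutation can contribute. *)
have K (s : 'S_r) : (expo (j \o s) i + m)%MM == (expo j k + m')%MM ->
    [/\ i = k, m = m' & s = 1%g].
  move=> /eqP eqm; have js_inj : injective (j \o s) by apply: inj_comp => //; apply: perm_inj.
  have iks a : i a = k (s a).
    have /mnmP/(_ (j (s a))) := eqm.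
    by rewrite !mnmDE m0 m'0 (expoE i a js_inj) expoE // !addn0 => /val_inj.
  have ik : i = k.
    by apply: increasing_eq => // _ /codomP[a ->]; rewrite iks codom_f.
  have s1 : s = 1%g.
    apply/perm.permP => a; rewrite perm1; apply: (increasing_inj k_incr).
    by rewrite -iks ik.
  split=> //; move: eqm; rewrite s1 ik.
  have -> : expo (j \o (1%g : 'S_r)) k = expo j k.
    by apply: eq_bigr => a _; rewrite /= perm1.
  by move/addmI.
rewrite (bigD1 1%g) //= big1 ?addr0 => [|s s1]; last first.
  by case: eqP => [/eqP/K[_ _ s1']|]; [rewrite s1' eqxx in s1|rewrite mulr0].
rewrite odd_perm1 mul1r; congr (_%:R); congr nat_of_bool; apply/idP/idP => [/K[-> -> _]|].
  by rewrite !eqxx.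
case/andP=> /eqP -> /eqP ->; apply/eqP; congr (_ + _)%MM.
by apply: eq_bigr => a _; rewrite /= perm1.
Qed.

End Alternants.

(** Taking the coefficient at m k isolates a k. *)
Lemma spanned_ev_inj (F : fieldType) n (V : lmodType F) (f : {linear V -> {mpoly F[n]}})
    (I : finType) (P : pred I) (v : I -> V) (m : I -> 'X_{1..n}) (a : I -> F) :
  (forall i k, P i -> P k -> (f (v i))@_(m k) = (i == k)%:R) ->
  f (\sum_(i | P i) a i *: v i) = 0 -> \sum_(i | P i) a i *: v i = 0.
Proof.
move=> dual fa0; apply: big1 => k Pk.
have := congr1 (mcoeff (m k)) fa0; rewrite mcoeff0 linear_sum raddf_sum /=.
rewrite (bigD1 k) //= linearZ /= mcoeffZ dual // eqxx mulr1 big1 ?addr0.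
  by move=> ->; rewrite scale0r.
by move=> i /andP[Pi ik]; rewrite linearZ /= mcoeffZ dual // (negPf ik) mulr0.
Qed.

Section GenericPoint.
Variables (F : fieldType) (N d : nat).
Local Notation R := {mpoly F[N.+1]}.

Definition gen_pt (c : 'I_N.+1) : 2.-tuple R := [tuple 1; 'X_c].

Lemma sym_ev_gen_pt c (b : 'I_N.+1) (i : 'I_c.+1) : sym_ev (gen_pt b) (symX F i) = 'X_b ^+ i.
Proof. by rewrite sym_ev_symX !(tnth_nth 0) /= expr1n mul1r. Qed.

Lemma alternant_ev r c (j : 'I_r -> 'I_N.+1) (i : mindex c r) :
  ext_ev (fun b => gen_pt (j b)) (Fwedge F i) = \det (\matrix_(a, b) 'X_(j b) ^+ i a).
Proof.
rewrite ext_ev_Fwedge; congr (\det _).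
by apply/matrixP => a b; rewrite !mxE sym_ev_gen_pt.
Qed.

Lemma ext_gen_inj c (w : ext N.+1 (Sym F c)) : ext_ev gen_pt w = 0 -> w = 0.
Proof.
rewrite [w]ext_expandE /ext_expand.
apply: (spanned_ev_inj (m := fun k => (expo id k + 0)%MM)) => i k i_incr k_incr.
rewrite /= alternant_ev.
have := @alternant_coef F _ _ _ id i k 0%MM 0%MM (fun _ _ => id)
  (mnm0E (n:=_)) (mnm0E (n:=_)) i_incr k_incr.
by rewrite mpolyX0 mulr1 eqxx andbT.
Qed.

Lemma target_gen_inj b (q : tensor (ext N (Sym F d)) (Sym F d)) :
  target_ev gen_pt b q = 0 -> q = 0.
Proof.
have [a ->] := tensor_ext_decomp q.
apply: (spanned_ev_inj (m := fun p => (expo (fintype.lift b) p.1 + U_(b) *+ (p.2 : 'I_d.+1))%MM)).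
move=> [i j] [k l] /= i_incr k_incr.
have U0 (h : 'I_d.+1) c : (U_(b) *+ h)%MM (fintype.lift b c) = 0%N.
  by rewrite mulmnE mnm1E (negPf (neq_lift _ _)).
have Uinj (h h' : 'I_d.+1) : ((U_(b) *+ h)%MM == (U_(b) *+ h')%MM :> 'X_{1..N.+1}) = (h == h').
  apply/eqP/eqP => [/mnmP/(_ b)|->//].
  by rewrite !mulmnE mnm1E eqxx !mul1n => /val_inj.
rewrite xpair_eqE -Uinj -(alternant_coef F (@lift_inj _ b) (U0 j) (U0 l) i_incr k_incr).
rewrite /target_ev /Ften; set t := tensor_ev _ _ _.
have -> : t = ext_ev (fun c => gen_pt (fintype.lift b c)) (Fwedge F i)
    * sym_ev (gen_pt b) (symX F j).
  exact: tensor_evE.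
by rewrite alternant_ev (sym_ev_gen_pt b j) mpolyXn.
Qed.

Lemma bracket_gen_pt (c b : 'I_N.+1) : bracket (gen_pt c) (gen_pt b) = 'X_c - 'X_b.
Proof. by rewrite /bracket !(tnth_nth 0) /= mulr1 mul1r. Qed.

Lemma mpolyXU_inj : injective (fun b : 'I_N.+1 => 'X_b : R).
Proof.
move=> b c /(congr1 (mcoeff U_(b)%MM)); rewrite !mcoeffX eqxx.
have [/mnmP/(_ b) + _|_ /eqP] := eqVneq U_(c)%MM U_(b)%MM; last by rewrite oner_eq0.
by rewrite !mnm1E eqxx; case: eqP.
Qed.

Lemma bracket_prod_gen_pt_neq0 b : bracket_prod gen_pt b != 0.
Proof.
apply/prodf_neq0 => c _; rewrite bracket_gen_pt subr_eq0.
by apply/eqP => /mpolyXU_inj/eqP; rewrite eq_sym (negPf (neq_lift _ _)).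
Qed.

(** The first coordinate of the moved point is the combination of 1 and X_b with
    the entries of the first column of g, and this column is not zero. *)
Lemma gen_pt_act_neq0 (g : SL2 F) b : tnth (pt_act (gen_pt b) g) ord0 != 0.
Proof.
rewrite pt_actE !(tnth_nth 0) /= mulr1; apply/eqP => E.
have g0 : (g : 'M_2) ord0 ord0 = 0.
  have := congr1 (mcoeff 0%MM) E.
  by rewrite mcoeffD mcoeffCM mcoeffC eqxx mcoeffX mnm1_eq0 mulr0 addr0 mulr1 mcoeff0.
have g1 : (g : 'M_2) ord_max ord0 = 0.
  have := congr1 (mcoeff U_(b)%MM) E.
  by rewrite mcoeffD mcoeffCM mcoeffC mcoeffX mnm1_eq0 eqxx mulr0 add0r mulr1 mcoeff0.
by have /eqP := SL2_det g; rewrite det2 g0 g1 mul0r mulr0 subr0 eq_sym oner_eq0.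
Qed.

(** * Interpolation at the generic point *)

Lemma eq_poly_gen_pt (p q : {poly R}) : (size p <= N.+1)%N -> (size q <= N.+1)%N ->
  (forall b : 'I_N.+1, p.['X_b] = q.['X_b]) -> p = q.
Proof.
move=> sp sq pq; apply/eqP; rewrite -subr_eq0; apply/eqP.
apply: (@roots_geq_poly_eq0 _ _ (codom (fun b : 'I_N.+1 => 'X_b : R))).
- by apply/allP => _ /codomP[b ->]; rewrite /root hornerD hornerN pq subrr.
- by apply/injectiveP; apply: mpolyXU_inj.
- rewrite size_codom card_ord (leq_trans (size_polyD _ _)) // size_polyN.
  by rewrite geq_max sp.
Qed.

Definition source_poly (w : 'I_N.-1.+1 -> ext N.+1 (Sym F d.+1)) : {poly R} :=
  \poly_(s < N.-1.+1) ext_ev gen_pt (w (inord s)).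

Lemma source_poly_horner w b :
  (source_poly w).['X_b] = source_ev gen_pt b (\sum_s tens (symX F s) (w s)).
Proof.
rewrite horner_poly linear_sum; apply: eq_bigr => s _ /=.
by rewrite /source_ev tensor_evE /= sym_ev_gen_pt inord_val mulrC.
Qed.

Definition target_poly (q : tensor (ext N (Sym F d)) (Sym F d)) : {poly R} :=
  nodal_sum (fun b => 'X_b : R) (fun b => (-1) ^+ b * target_ev gen_pt b q).

Lemma target_poly_coefN q : (target_poly q)`_N = ext_ev gen_pt (mulwedge q).
Proof. by rewrite nodal_sum_coef mulwedge_ev. Qed.

Lemma target_poly_horner q b :
  (target_poly q).['X_b] = (-1) ^+ b * target_ev gen_pt b q * bracket_prod gen_pt b.
Proof.
rewrite [LHS](nodal_sum_horner (fun b => 'X_b : R)); congr (_ * _).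
by apply: eq_bigr => c _; rewrite bracket_gen_pt.
Qed.

End GenericPoint.

Section MulVariable.
Variables (F : fieldType) (d : nat).

Lemma mul_var_homog (j : 'I_2) (p : Sym F d) : 'X_j * (p : {mpoly F[2]}) \is d.+1.-homog.
Proof.
by rewrite -[d.+1]add1n; apply: dhomogM; [rewrite dhomogX /= mdeg1|apply: dhomog_is_dhomog].
Qed.

Definition mul_var j p : Sym F d.+1 := DHomog (mul_var_homog j p).

Lemma sym_ev_mul_var n (z : 2.-tuple {mpoly F[n]}) j p :
  sym_ev z (mul_var j p) = tnth z j * sym_ev z p.
Proof. by rewrite /sym_ev /= rmorphM /= comp_mpolyXU -tnth_nth. Qed.
End MulVariable.

Section Surjectivity.
Variables (F : fieldType) (N d : nat).

(** For q = v_1 /\ ... /\ v_N (x) f, target_poly q is up to sign a determinant with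
    rows (X_c - T) v_a(x_c) and f(x_c).  At x_c = (1, X_c) these are values of
    Y v_a - T X v_a and of X f, where the factor X only raises the degree to
    d + 1.  Expanding in T gives determinants of values of elements of Sym d.+1. *)
Lemma target_poly_coef_ev (q : tensor (ext N (Sym F d)) (Sym F d)) s :
  exists w : ext N.+1 (Sym F d.+1), ext_ev (@gen_pt F N) w = (target_poly q)`_s.
Proof.
elim/tensor_wedge_ind: q => [a q q' [w Ew] [w' Ew']|v f].
  exists (a *: w + w'); rewrite linearP /= Ew Ew' /target_poly !coef_sum scaler_sumr -big_split.
  by apply: eq_bigr => b _; rewrite !coefZ linearP mulrDr mulrDl -scalerAr -scalerAl.
(* The rows are v1 + T v2; the row of f is constant in T. *)
pose v1 := snoc [ffun a => mul_var ord_max (v a)] (mul_var ord0 f).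
pose v2 := snoc [ffun a => - mul_var ord0 (v a)] 0.
exists ((-1) ^+ N *: \sum_(J : {set 'I_N.+1} | #|J| == s)
  wedge [ffun a => if a \in J then v2 a else v1 a]).
have -> : target_poly (tens (wedge v) f) = nodal_sum (fun b => 'X_b : {mpoly F[N.+1]})
    (fun b => (-1) ^+ b * (\det (\matrix_(a, c) sym_ev (gen_pt F (fintype.lift b c)) (v a))
      * sym_ev (gen_pt F b) f)).
  apply: eq_bigr => b _; congr (_ * _ *: _).
  by rewrite -ext_evE; apply: tensor_evE.
rewrite (nodal_sum_coef_det (fun c => 'X_c) (fun a c => sym_ev (gen_pt F c) (v a))
  (fun c => sym_ev (gen_pt F c) f)) linearZ linear_sum /= -mul_mpolyC rmorph_sign.
congr (_ * _); apply: eq_bigr => J _; rewrite ext_evE; congr (\det _).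
apply/matrixP => a c; rewrite !mxE ffunE; case: ifP => _; rewrite ffunE.
  case: unliftP => [a1 _|_] /=; last by rewrite linear0.
  by rewrite ffunE linearN /= sym_ev_mul_var !(tnth_nth 0) /= mul1r.
case: unliftP => [a1 _|_] /=; last by rewrite sym_ev_mul_var !(tnth_nth 0) /= mul1r.
by rewrite ffunE sym_ev_mul_var (tnth_nth 0).
Qed.

End Surjectivity.

(** * The isomorphism *)

Lemma mulwedge_act (F : fieldType) (G : groupType) N (V : lmodType F)
    (rV : representation G V) g (q : tensor (ext N V) V) :
  mulwedge (tensor_rep (ext_rep N rV) rV g q) = ext_rep N.+1 rV g (mulwedge q).
Proof.
elim/tensor_wedge_ind: q => [a q q' Eq Eq'|v w]; first by rewrite !linearP /= Eq Eq'.
have wedge_act r (u : {ffun 'I_r -> V}) : ext_rep r rV g (wedge u) = wedge [ffun a => rV g (u a)].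
  exact: ext_mapE.
rewrite tensor_repE wedge_act !mulwedgeE wedge_act; congr wedge; apply/ffunP => a.
by rewrite !ffunE; case: unliftP => [a1 _|_] /=; rewrite ?ffunE.
Qed.

Section Main.
Variables (F : fieldType) (N d : nat) (N_gt0 : (0 < N)%N).

Lemma gen_pt_neq0 (b : 'I_N.+1) : tnth (gen_pt F b) ord0 != 0.
Proof. by rewrite (tnth_nth 0) oner_eq0. Qed.

(** Both sides have the same product with the brackets at the generic points,
    since moving the points by g does not change the brackets. *)
Lemma phi_equivariant g t :
  phi F N d (tensor_rep (sym_rep F N.-1) (ext_rep N.+1 (sym_rep F d.+1)) g t)
  = tensor_rep (ext_rep N (sym_rep F d)) (sym_rep F d) g (phi F N d t).
Proof.
apply/eqP; rewrite -subr_eq0; apply/eqP; apply: (@target_gen_inj _ _ _ ord_max).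
rewrite linearB /= target_ev_act; apply/eqP; rewrite subr_eq0; apply/eqP.
apply: (mulIf (bracket_prod_gen_pt_neq0 F (@ord_max N))).
apply: (@mulfI _ ((-1) ^+ (@ord_max N))); first by rewrite signr_eq0.
rewrite !mulrA phi_ev ?gen_pt_neq0 // source_ev_act -(bracket_prod_act _ _ g).
by rewrite phi_ev // gen_pt_act_neq0.
Qed.

(** Two polynomials of degree at most N that agree at N + 1 nodes. *)
Lemma target_poly_phi (w : 'I_N.-1.+1 -> ext N.+1 (Sym F d.+1)) :
  target_poly (phi F N d (\sum_s tens (symX F s) (w s))) = source_poly w.
Proof.
apply: eq_poly_gen_pt => [||b]; first exact: size_nodal_sum.
  by apply: leq_trans (size_poly _ _) _; rewrite prednK.
by rewrite target_poly_horner phi_ev ?gen_pt_neq0 // source_poly_horner.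
Qed.

Lemma phi_injective : injective (phi F N d).
Proof.
move=> t t' tt'; apply/eqP; rewrite -subr_eq0; apply/eqP.
have [w Ew] := tensor_sym_decomp (t - t').
have := target_poly_phi w; rewrite -Ew linearB /= tt' subrr => E.
rewrite Ew big1 // => s _; suff -> : w s = 0 by rewrite linear0.
apply: ext_gen_inj; have := congr1 (fun p : {poly _} => p`_s) E.
rewrite coef_poly ltn_ord inord_val => <-.
rewrite coef_sum big1 // => b _; by rewrite linear0 mulr0 scale0r coef0.
Qed.

(** The coefficient of T^N is the obstruction, and it is absent from source_poly. *)
Lemma phi_Delta t : phi F N d t \in Delta N (Sym F d).
Proof.
have [w ->] := tensor_sym_decomp t; rewrite unfold_in; apply/eqP; apply: ext_gen_inj.
by rewrite -target_poly_coefN target_poly_phi coef_poly prednK // ltnn.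
Qed.

(** The preimage is read off from the coefficients of target_poly q below T^N. *)
Lemma Delta_phi q : q \in Delta N (Sym F d) -> exists t, phi F N d t = q.
Proof.
rewrite unfold_in => /eqP q_ker.
have [w Ew] : exists w : 'I_N.-1.+1 -> ext N.+1 (Sym F d.+1),
    forall s, ext_ev (@gen_pt F N) (w s) = (target_poly q)`_s.
  exact: (fin_all_exists (fun s : 'I_N.-1.+1 => target_poly_coef_ev q s)).
have Eq : source_poly w = target_poly q.
  apply/polyP => s; rewrite coef_poly; case: ltnP => sN; first by rewrite Ew inordK.
  have [->|sN'] := eqVneq s N; first by rewrite target_poly_coefN q_ker linear0.
  by rewrite nth_default // (leq_trans (size_nodal_sum _ _)) //; lia.
exists (\sum_s tens (symX F s) (w s)).
apply/eqP; rewrite -subr_eq0; apply/eqP; apply: (@target_gen_inj _ _ _ ord_max).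
rewrite linearB /=; apply/eqP; rewrite subr_eq0; apply/eqP.
apply: (mulIf (bracket_prod_gen_pt_neq0 F (@ord_max N))).
apply: (@mulfI _ ((-1) ^+ (@ord_max N))); first by rewrite signr_eq0.
by rewrite !mulrA -!target_poly_horner target_poly_phi Eq.
Qed.
End Main.

Theorem theorem1p1 (F : fieldType) (N d : nat) (hN : (0 < N)%N) :
  rep_iso_onto
    (tensor_rep (sym_rep F N.-1) (ext_rep N.+1 (sym_rep F d.+1)))
    (tensor_rep (ext_rep N (sym_rep F d)) (sym_rep F d))
    (Delta N (Sym F d))
    (phi F N d).
Proof.
split; [split | exact: phi_equivariant | exact: phi_injective |].
- split=> [|a u v]; rewrite !unfold_in; first by rewrite linear0.
  by move=> /eqP u0 /eqP v0; rewrite linearP /= u0 v0 scaler0 addr0.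
- move=> g q; rewrite !unfold_in => /eqP q0.
  by rewrite mulwedge_act q0 linear0.
- by move=> q; split=> [/(Delta_phi hN)//|[t <-]]; apply: phi_Delta.
Qed.
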